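(* Let $x\in(0,1)$ be a fixed point of $f$, and consider the stationary recursive tree process with Bernoulli$(1-x)$ marginals for the values at even levels (i.e. with $\mu$ the distribution putting mass $x$ at $0$ and mass $1-x$ at $1$). The process is endogenous if and only if $f'(x)\le1$.
   Context: Let $(p_k)_{k\ge 1}$ be a probability mass function on $\{1,2,3,\dots\}$ (the offspring distribution), $G(x)=\sum_{k\ge1}p_kx^k$ for $x\in[0,1]$ its probability generating function, $R(x)=1-G(x)$ and $f(x)=R(R(x))$ for $x\in[0,1]$. For a probability distribution $\mu$ on $[0,1]$, let $T(\mu)$ be the law of $\min_{1\le i\le M}\max_{1\le j\le M_i}X^{(i,j)}$, where $M,M_1,M_2,\dots$ are i.i.d. draws from the offspring distribution and the $X^{(i,j)}$ are i.i.d. with law $\mu$, independent of $M,M_1,M_2,\dots$. Equivalently $T(\mu)[0,y]=f(\mu[0,y])$ for all $y\in[0,1]$. If $T(\mu)=\mu$, the stationary recursive tree process with marginals $\mu$ at even levels is the pair consisting of the infinite Galton–Watson tree $\mathbb{T}$ with the given offspring distribution (root at level $0$) and values $(X_v)_{v\in\mathbb{T}}$ in $[0,1]$ whose joint law is determined by the following: for every $n$, conditionally on the structure of the tree up to level $2n$, the values at the level-$2n$ nodes are i.i.d. with law $\mu$; and for every node $v$, $X_v$ is the minimum of the values of the children of $v$ if $v$ is at an even level, and the maximum of the values of the children of $v$ if $v$ is at an odd level. (The resulting laws for different $n$ are consistent because $T(\mu)=\mu$, so the process exists by Kolmogorov's extension theorem.) When $f(x)=x$, the Bernoulli$(1-x)$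 distribution satisfies $T(\mu)=\mu$. The process is called endogenous if the value at the root is (up to null sets) measurable with respect to the structure of the tree $\mathbb{T}$.
   Formalization: The offspring distribution is additionally assumed to satisfy p_1 ≠ 1; if p_1 = 1 then f(x) = x and f'(x) = 1 for all x, but the tree is a deterministic line and the non-constant Bernoulli root value is not endogenous, so the claim fails. *)

(* Defs.v *)
From HB Require Import structures.
From mathcomp Require Import all_boot all_order all_algebra.
From mathcomp Require Import all_classical all_reals all_analysis.

Set Implicit Arguments.
Unset Strict Implicit.
Unset Printing Implicit Defensive.

Import Order.TTheory GRing.Theory Num.Theory.
Import numFieldNormedType.Exports.

Local Open Scope classical_set_scope.
Local Open Scope ring_scope.

Record offspring_distribution (R : realType) (p : nat -> R) : Prop := {
  offspring_ge0 : forall k, 0 <= p k;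
  offspring_0 : p 0%N = 0;
  offspring_sum1 : series p @ \oo --> (1 : R) }.

(* [offspring_gf p x], [offspring_R p x] and [minimax_map p x] are G(x), R(x)
   and f(x) when 0 <= x <= 1; the values elsewhere carry no meaning. *)
Definition offspring_gf (R : realType) (p : nat -> R) (x : R) : R :=
  limn (series (fun k => p k * x ^+ k)).

Definition offspring_R (R : realType) (p : nat -> R) (x : R) : R :=
  1 - offspring_gf p x.

Definition minimax_map (R : realType) (p : nat -> R) (x : R) : R :=
  offspring_R p (offspring_R p x).

Definition bool01 (R : realType) (b : bool) : R := b%:R.

Lemma measurable_bool01 (R : realType) : measurable_fun setT (@bool01 R).
Proof. by []. Qed.

HB.instance Definition _ (R : realType) :=
  isMeasurableFun.Build _ _ bool R (@bool01 R) (@measurable_bool01 R).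

(* The Bernoulli(q) law on the real line: mass q at 1 and 1 - q at 0. *)
Definition bernoulli_law (R : realType) (q : R) : probability R R :=
  distribution (bernoulli_prob q) (@bool01 R).

(* Ulam-Harris words, written from the leaf to the root: [::] is the root and
   i :: v is the i-th child of v, so that the level of v is [size v]. *)
Definition node : Type := seq nat.

(* The tree in which v has [c v] children, numbered 0, ..., c v - 1; the values
   of c at words outside of the tree are irrelevant. *)
Fixpoint in_tree (c : node -> nat) (v : node) : bool :=
  if v is i :: u then (i < c u)%N && in_tree c u else true.

Definition tree_upto (c : node -> nat) (m : nat) : set node :=
  [set v | in_tree c v /\ (size v <= m)%N].

Section tree_process.
Context d (Omega : measurableType d) (R : realType) (P : probability Omega R).

Record galton_watson (p : nat -> R) (N : node -> Omega -> nat) : Prop := {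
  gw_measurable : forall v, measurable_fun setT (N v);
  gw_iid : forall (s : seq node) (k : node -> nat), uniq s ->
    P [set w | forall v, v \in s -> N v w = k v] =
      (\prod_(v <- s) p (k v))%:E }.

(* The value at v in terms of the values at its children. The values lie in
   [0, 1] and a node has at least one child, so 1 (resp. 0), the neutral element
   of min (resp. max) on [0, 1], does not affect the result. *)
Definition node_rule (c : node -> nat) (a : node -> R) (v : node) : R :=
  if odd (size v) then \big[Num.max/0]_(i < c v) a (nat_of_ord i :: v)
  else \big[Num.min/1]_(i < c v) a (nat_of_ord i :: v).

(* X v w is meaningful only when v belongs to the tree. In [rtp_cond] the
   structure t of the tree up to level 2n is a discrete random variable, and the
   conditional law given it is written without dividing by the probability of t.
   Taken together, the fields force T(mu) = mu. *)
Record stationary_rtp (p : nat -> R) (mu : probability R R)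
    (N : node -> Omega -> nat) (X : node -> Omega -> R) : Prop := {
  rtp_gw : galton_watson p N;
  rtp_measurable : forall v,
    measurable_fun [set w | in_tree (N ^~ w) v] (X v);
  rtp_01 : {ae P, forall w, forall v, in_tree (N ^~ w) v -> 0 <= X v w <= 1};
  rtp_rule : {ae P, forall w, forall v, in_tree (N ^~ w) v ->
    X v w = node_rule (N ^~ w) (X ^~ w) v};
  rtp_cond : forall (n : nat) (t : set node) (s : seq node)
      (B : node -> set R),
    uniq s -> (forall v, v \in s -> t v /\ size v = n.*2) ->
    (forall v, measurable (B v)) ->
    P [set w | tree_upto (N ^~ w) n.*2 = t /\
               forall v, v \in s -> B v (X v w)] =
      (P [set w | tree_upto (N ^~ w) n.*2 = t] *
       \prod_(v <- s) mu (B v))%E }.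

Definition tree_sigma_algebra (N : node -> Omega -> nat) : set (set Omega) :=
  <<s [set A | exists v : node, A = [set w | in_tree (N ^~ w) v]] >>.

Definition endogenous (N : node -> Omega -> nat) (X : node -> Omega -> R) :
    Prop :=
  exists Y : Omega -> R,
    (forall B : set R, measurable B -> tree_sigma_algebra N (Y @^-1` B)) /\
    {ae P, forall w, X [::] w = Y w}.

End tree_process.

(* Main.v *)
(* Let S(v) be the conditional probability, given the tree up to level 2n, that
   X_v = 1 if v is at an even level and that X_v = 0 if v is at an odd level.
   Then S(v) is the product of 1 - S(u) over the children u of v, so the first
   two moments of S propagate through G. If q_n is the probability that two
   copies of the root value, conditionally independent given that tree, both
   vanish, this gives q_(n+1) = h(q_n) with
   h(q) = 2x - 1 + G(1 - 2G(x) + G(q)), and x - q_n = E[S(1 - S)] at the root.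
   The map h is increasing and strictly convex, h(x) = x and h'(x) = f'(x), so
   q_n -> x iff f'(x) <= 1. Finally q_n -> x iff the root value is a limit in
   probability of functions of the tree up to level 2n, i.e. iff the process is
   endogenous. *)
Require Import Defs.
From mathcomp Require Import all_boot all_order all_algebra.
From mathcomp Require Import finmap.
From mathcomp Require Import all_classical all_reals all_analysis.
From mathcomp Require Import measurable_realfun ring lra.
Import Order.TTheory GRing.Theory Num.Theory.
Import numFieldNormedType.Exports.
Local Open Scope classical_set_scope.
Local Open Scope ring_scope.

(** * Generating functions *)

(** No second copy of the process and no conditional expectation is constructed. The tree up to a
    finite level has countably many possible structures, so conditioning is a sum over structures,
    and S is tied to the process only by E[1_B 1_{X = 1}] = E[1_B S] at the root, for events B
    decided by the tree up to level 2n. Accordingly q_n is defined as 1 - 2(1 - x) + E[S^2], the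
    value that inclusion-exclusion gives for two conditionally independent copies.

    The critical case f'(x) = 1 is the obstacle: linearisation at x yields no contraction there.
    Instead of second derivatives, the tangent inequality for powers is used with an explicit
    quadratic remainder, kept for a single k with p_(k+2) > 0. It makes the gap x - q_n decrease by
    at least a constant times its square.

    The link between E[S(1 - S)] and endogeny is an estimate of guessing errors: the best guess of
    the root value from the tree up to level 2n fails with probability E[min(S, 1 - S)], and s(1 -
    s) <= min(s, 1 - s) <= 2s(1 - s) on [0, 1]. *)

Section generating_function.
Context {R : realType}.

(** With [n = k + 2], the power minus its tangent is [(b - a) ^ 2] times the sum over [i <= k] of
    [(i + 1) a ^ i b ^ (k - i)]; a single copy of [a ^ k] is kept. This remainder is the source of
    all strict convexity below. *)
Lemma exprn_tangent2 (a b : R) (k : nat) : 0 <= a -> 0 <= b ->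
  a ^+ k.+2 + k.+2%:R * a ^+ k.+1 * (b - a) + a ^+ k * (b - a) ^+ 2
    <= b ^+ k.+2.
Proof.
move=> a0 b0; elim: k => [|k IH].
  by rewrite expr0 expr1 mul1r !expr2 le_eqVlt; apply/orP; left; apply/eqP; ring.
rewrite [leRHS]exprS; apply: le_trans (ler_wpM2l b0 IH).
rewrite -subr_ge0.
have -> : b * (a ^+ k.+2 + k.+2%:R * a ^+ k.+1 * (b - a) + a ^+ k * (b - a) ^+ 2) -
  (a ^+ k.+3 + k.+3%:R * a ^+ k.+2 * (b - a) + a ^+ k.+1 * (b - a) ^+ 2) =
  a ^+ k * (b - a) ^+ 2 * (k.+1%:R * a + b).
  by rewrite !exprS -[k.+3]addn3 -[k.+2]addn2 -[k.+1]addn1 !natrD; ring.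
apply: mulr_ge0; last by rewrite addr_ge0 ?mulr_ge0 ?ler0n.
by rewrite mulr_ge0 ?sqr_ge0 ?exprn_ge0.
Qed.

Lemma exprn_tangent (a b : R) (k : nat) : 0 <= a -> 0 <= b ->
  a ^+ k + k%:R * a ^+ k.-1 * (b - a) <= b ^+ k.
Proof.
case: k => [|[|k]] a0 b0.
- by rewrite !expr0 mul0r mul0r addr0.
- by rewrite !expr1 expr0; lra.
- apply: le_trans (exprn_tangent2 _ _ k a0 b0).
  by rewrite lerDl mulr_ge0 ?sqr_ge0 ?exprn_ge0.
Qed.

(** The tangent inequality at [z] gives [(n + 1) z ^ n (y - z) <= y ^ (n + 1)], so the series at
    [y], divided by [y - z], dominates the differentiated one. *)
Lemma is_cvg_pseries_diffs (c : nat -> R) (y z : R) :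
  (forall k, 0 <= c k) -> 0 <= z < y ->
  cvgn (pseries c y) -> cvgn (pseries (pseries_diffs c) z).
Proof.
move=> c0 /andP[z0 zy] cy.
have y0 : 0 <= y by rewrite (le_trans z0) ?ltW.
have cy' : cvgn (series (fun i => c i.+1 * y ^+ i.+1)).
  rewrite (_ : series _ = fun n => series (fun i => c i * y ^+ i) n.+1 - c 0%N).
    have /cvg_ex[l hl] := cy; apply/cvg_ex; exists (l - c 0%N) => /=.
    by apply: cvgB; [rewrite (cvg_shiftS (pseries c y))|exact: cvg_cst].
  apply/funext => n.
  by rewrite !seriesEnat/= big_nat_recl//= expr0 mulr1 addrC addKr.
apply: (@series_le_cvg _ _ (fun i => (y - z)^-1 * (c i.+1 * y ^+ i.+1))).
- by move=> n; rewrite !mulr_ge0 ?exprn_ge0.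
- by move=> n; rewrite !mulr_ge0 ?exprn_ge0 ?invr_ge0 ?subr_ge0 ?(ltW zy).
- move=> n; rewrite /pseries_diffs [leRHS]mulrC ler_pdivlMr ?subr_gt0//.
  have : n.+1%:R * z ^+ n * (y - z) <= y ^+ n.+1.
    by apply: le_trans (exprn_tangent _ _ n.+1 z0 y0); rewrite lerDr exprn_ge0.
  move=> /(ler_wpM2l (c0 n.+1)) yn; apply: le_trans yn.
  by rewrite le_eqVlt !mulrA [c _ * _]mulrC eqxx.
exact: (@is_cvg_seriesZ _ _ (y - z)^-1 cy').
Qed.

Variable p : nat -> R.
Hypothesis hp : offspring_distribution p.

Let p_ge0 := offspring_ge0 hp.

Lemma is_cvg_offspring_gf (y : R) : 0 <= y <= 1 -> cvgn (pseries p y).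
Proof.
move=> /andP[y0 y1]; apply: (@series_le_cvg _ _ p) => //.
- by move=> n; rewrite mulr_ge0 ?exprn_ge0.
- by move=> n; rewrite -[leRHS]mulr1 ler_wpM2l// exprn_ile1.
- by apply/cvg_ex; exists 1; exact: (offspring_sum1 hp).
Qed.

Definition offspring_gf' (y : R) : R := limn (pseries (pseries_diffs p) y).

Lemma is_derive_offspring_gf (y : R) : 0 <= y < 1 ->
  is_derive y (1 : R) (offspring_gf p) (offspring_gf' y).
Proof.
move=> /andP[y0 y1].
(* [pseries_snd_diffs] asks for convergence of the twice differentiated series beyond [y]. Each
   differentiation costs a strictly smaller point, hence the chain [y < y2 < y3 < y4 < 1]. *)
pose y3 := (y + 1) / 2; pose y2 := (y + y3) / 2; pose y4 := (y3 + 1) / 2.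
have y30 : 0 <= y3 < y4 by rewrite /y4 /y3; lra.
have y20 : 0 <= y2 < y3 by rewrite /y2 /y3; lra.
have y40 : 0 <= y4 <= 1 by rewrite /y4 /y3; lra.
have c4 := is_cvg_offspring_gf _ y40.
have c3 := is_cvg_pseries_diffs _ _ _ p_ge0 y30 c4.
have c2 : cvgn (pseries (pseries_diffs (pseries_diffs p)) y2).
  by apply: is_cvg_pseries_diffs y20 c3 => k; rewrite mulr_ge0.
have lt2 : 0 <= y2 < 1 by rewrite /y2 /y3; lra.
apply: (@pseries_snd_diffs _ _ y2) => //.
- by apply: is_cvg_offspring_gf; lra.
- by apply: (@is_cvg_pseries_diffs _ y4) => //; rewrite /y4 /y2 /y3; lra.
- by rewrite !ger0_norm ?y0//; rewrite /y2 /y3; lra.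
Qed.

(** Average of the tangent inequalities for powers with weights [p i]; every remainder is dropped
    except that of the power [k + 2]. The base point stays below 1, where the derivative of G may be
    infinite. *)
Lemma offspring_gf_tangent (a b : R) (k : nat) : 0 <= a < 1 -> 0 <= b <= 1 ->
  p k.+2 * a ^+ k * (b - a) ^+ 2 <=
  offspring_gf p b - offspring_gf p a - offspring_gf' a * (b - a).
Proof.
move=> /andP[a0 a1] /andP[b0 b1].
have ca : cvgn (pseries p a) by apply: is_cvg_offspring_gf; lra.
have cb : cvgn (pseries p b) by apply: is_cvg_offspring_gf; lra.
have cd : cvgn (pseries (pseries_diffs p) a).
  by apply: (@is_cvg_pseries_diffs _ 1) => //; [lra|apply: is_cvg_offspring_gf; lra].
pose u i := p i * (b ^+ i - (a ^+ i + i%:R * a ^+ i.-1 * (b - a))).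
have u0 i : 0 <= u i by rewrite mulr_ge0// subr_ge0 exprn_tangent.
have su : series u @ \oo -->
    offspring_gf p b - offspring_gf p a - offspring_gf' a * (b - a).
  rewrite (_ : series u = pseries p b - pseries p a -
     (fun n => series (fun i => i%:R * p i * a ^+ i.-1) n * (b - a))).
    apply: cvgB; first exact: cvgB.
    by apply: cvgMl; exact: pseries_diffs_equiv.
  apply/funext => n; rewrite !fctE /pseries !seriesEnat/= mulr_suml -!sumrB.
  by apply: eq_bigr => i _; rewrite /u; ring.
rewrite -(cvg_lim _ su)//.
have ndu : nondecreasing_seq (series u) by apply: nondecreasing_series.
(* With [k + 3] terms the last index summed is [k + 2]. *)
apply: le_trans (nondecreasing_cvgn_le ndu _ k.+3); last by apply/cvg_ex; eexists; exact: su.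
rewrite seriesEnat/= big_nat_recr//= -[leLHS]add0r lerD ?sumr_ge0//.
rewrite /u -mulrA ler_wpM2l// lerBrDl.
exact: exprn_tangent2.
Qed.

Lemma offspring_gf_ge_pk (y : R) (k : nat) : 0 <= y <= 1 ->
  p k * y ^+ k <= offspring_gf p y.
Proof.
move=> y01; have cy := is_cvg_offspring_gf _ y01; move: y01 => /andP[y0 y1].
have nd : nondecreasing_seq (pseries p y).
  by apply: nondecreasing_series => // i _ _; rewrite mulr_ge0 ?exprn_ge0.
apply: le_trans (nondecreasing_cvgn_le nd cy k.+1).
rewrite /pseries seriesEnat/= big_nat_recr//= -[leLHS]add0r lerD ?sumr_ge0//.
by move=> i _; rewrite mulr_ge0 ?exprn_ge0.
Qed.

Lemma offspring_gf1 : offspring_gf p 1 = 1.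
Proof.
rewrite /offspring_gf (_ : (fun k => _) = p); last first.
  by apply/funext => k; rewrite expr1n mulr1.
exact: cvg_lim (offspring_sum1 hp).
Qed.

Lemma offspring_gf'_ge_pk (y : R) (k : nat) : 0 <= y < 1 ->
  k.+1%:R * p k.+1 * y ^+ k <= offspring_gf' y.
Proof.
move=> /andP[y0 y1].
have cd : cvgn (pseries (pseries_diffs p) y).
  by apply: (@is_cvg_pseries_diffs _ 1) => //; [lra|apply: is_cvg_offspring_gf; lra].
have nd : nondecreasing_seq (pseries (pseries_diffs p) y).
  by apply: nondecreasing_series => // i _ _; rewrite !mulr_ge0 ?exprn_ge0.
apply: le_trans (nondecreasing_cvgn_le nd cd k.+1).
rewrite /pseries seriesEnat/= big_nat_recr//= -[leLHS]add0r lerD ?sumr_ge0//.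
by move=> i _; rewrite !mulr_ge0 ?exprn_ge0.
Qed.

Hypothesis hp1 : p 1%N != 1.

(** The degenerate case is excluded here: if [p 1 = 1], then f is the identity and f' = 1, while the
    tree is a bare path that reveals nothing about the root value. *)
Lemma exists_branching : exists k, 0 < p k.+2.
Proof.
apply: contrapT => /forallNP no; move/eqP: hp1; apply.
have p0 k : p k.+2 = 0.
  by apply/eqP; rewrite eq_le p_ge0 andbT leNgt; apply/negP/no.
rewrite -(cvg_lim _ (offspring_sum1 hp))//; apply/esym/cvg_lim => //.
rewrite -(cvg_shiftn 2)/=.
rewrite (_ : (fun n => _) = fun=> p 1%N); first exact: cvg_cst.
apply/funext => n; rewrite addn2 seriesEnat/= 2?big_nat_recl//=.
by rewrite (offspring_0 hp) add0r big1 ?addr0.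
Qed.

Lemma offspring_gf'_ge0 (a : R) : 0 <= a < 1 -> 0 <= offspring_gf' a.
Proof.
move=> a01; apply: le_trans (offspring_gf'_ge_pk _ 0 a01).
by rewrite !mulr_ge0 ?exprn_ge0//; case/andP: a01.
Qed.

Lemma offspring_gf'_gt0 (a : R) : 0 < a < 1 -> 0 < offspring_gf' a.
Proof.
move=> a01; have [k pk] := exists_branching.
have a01' : 0 <= a < 1 by lra.
apply: lt_le_trans (offspring_gf'_ge_pk _ k.+1 a01').
by case/andP: a01 => a0 a1; rewrite pmulr_lgt0 ?exprn_gt0// mulr_gt0.
Qed.

Lemma offspring_gf_gt0 (a : R) : 0 < a < 1 -> 0 < offspring_gf p a.
Proof.
move=> a01; have [k pk] := exists_branching.
have a01' : 0 <= a <= 1 by lra.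
apply: lt_le_trans (offspring_gf_ge_pk _ k.+2 a01').
by case/andP: a01 => a0 a1; rewrite mulr_gt0 ?exprn_gt0.
Qed.

Lemma offspring_gf_le (a b : R) : 0 <= a -> a <= b -> b <= 1 ->
  offspring_gf p a <= offspring_gf p b.
Proof.
move=> a0; rewrite le_eqVlt => /predU1P[->//|ab] b1.
have [a01 b01] : 0 <= a < 1 /\ 0 <= b <= 1 by lra.
have := offspring_gf_tangent _ _ 0 a01 b01.
have : 0 <= p 2%N * a ^+ 0 * (b - a) ^+ 2 by rewrite mulr_ge0 ?sqr_ge0// mulr_ge0.
have := offspring_gf'_ge0 _ a01.
by nra.
Qed.

Lemma offspring_gf_lt1 (a : R) : 0 < a < 1 -> offspring_gf p a < 1.
Proof.
move=> a01; have a01' : 0 <= a < 1 by lra.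
have b01 : 0 <= (1 : R) <= 1 by rewrite ler01 lexx.
have := offspring_gf_tangent _ _ 0 a01' b01.
rewrite offspring_gf1.
have : 0 <= p 2%N * a ^+ 0 * (1 - a) ^+ 2 by rewrite mulr_ge0 ?sqr_ge0// mulr_ge0.
have := offspring_gf'_gt0 _ a01.
by nra.
Qed.

End generating_function.

(** * The two-copies map *)

Section two_copies_map.
Context {R : realType}.
Variable p : nat -> R.
Hypothesis hp : offspring_distribution p.
Hypothesis hp1 : p 1%N != 1.

Local Notation G := (offspring_gf p).
Local Notation G' := (offspring_gf' p).

Definition two_copies_map (x q : R) : R := 2 * x - 1 + G (1 - 2 * G x + G q).

Lemma offspring_R_gt0_lt1 (x : R) : 0 < x < 1 -> 0 < 1 - G x < 1.
Proof.
move=> hx.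
have := offspring_gf_gt0 _ hp hp1 _ hx; have := offspring_gf_lt1 _ hp hp1 _ hx.
lra.
Qed.

Lemma offspring_gf_fixed (x : R) : minimax_map p x = x -> G (1 - G x) = 1 - x.
Proof. by rewrite /minimax_map /offspring_R; lra. Qed.

Lemma derive1_minimax_map (x : R) : 0 < x < 1 ->
  derive1 (minimax_map p) x = G' (1 - G x) * G' x.
Proof.
move=> hx; have Gx01 := offspring_R_gt0_lt1 _ hx.
have dx : is_derive x (1 : R) G (G' x) by apply: is_derive_offspring_gf => //; lra.
have da : is_derive (1 - G x) (1 : R) G (G' (1 - G x)).
  by apply: is_derive_offspring_gf => //; lra.
have dR : is_derive x (1 : R) (fun y => 1 - G y) (- G' x).
  by rewrite -[- _]add0r; apply: is_deriveB.
have dc : is_derive x (1 : R) (G \o (fun y => 1 - G y)) (G' (1 - G x) *: - G' x).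
  exact: is_derive1_comp.
rewrite derive1E; apply: derive_val.
rewrite (_ : _ * _ = 0 - (G' (1 - G x) *: - G' x)); last first.
  by rewrite /GRing.scale/=; ring.
exact: is_deriveB.
Qed.

Lemma two_copies_map_fixed (x : R) : minimax_map p x = x ->
  two_copies_map x x = x.
Proof.
move=> /offspring_gf_fixed GGx.
rewrite /two_copies_map (_ : 1 - 2 * G x + G x = 1 - G x); last by ring.
by rewrite GGx; ring.
Qed.

Lemma is_derive_two_copies_map (x : R) : 0 < x < 1 ->
  is_derive x (1 : R) (two_copies_map x) (G' (1 - G x) * G' x).
Proof.
move=> hx; have Gx01 := offspring_R_gt0_lt1 _ hx.
have dx : is_derive x (1 : R) G (G' x) by apply: is_derive_offspring_gf => //; lra.
have da : is_derive (1 - 2 * G x + G x) (1 : R) G (G' (1 - G x)).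
  rewrite (_ : 1 - 2 * G x + G x = 1 - G x); last by ring.
  by apply: is_derive_offspring_gf => //; lra.
have dR : is_derive x (1 : R) (fun y => 1 - 2 * G x + G y) (G' x).
  by rewrite -[G' x]add0r; apply: is_deriveD.
have dc : is_derive x (1 : R) (G \o (fun y => 1 - 2 * G x + G y)) (G' (1 - G x) *: G' x).
  exact: is_derive1_comp.
rewrite (_ : _ * _ = 0 + (G' (1 - G x) *: G' x)); last first.
  by rewrite /GRing.scale/=; ring.
exact: is_deriveD.
Qed.

(** The bound on [1 - 2 * G x + G (q n)] keeps the argument of the outer G where [offspring_gf] is
    meaningful. For the actual orbit this number is E[(1 - S)^2] at an odd level. *)
Definition two_copies_orbit (x : R) (q : nat -> R) : Prop :=
  forall n, [/\ 0 <= q n <= x, 0 <= 1 - 2 * G x + G (q n) &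
    q n.+1 = two_copies_map x (q n)].

(** Two tangent inequalities are composed: the outer G, at [1 - G x], is only bounded by its
    tangent, while the inner G, at [x], keeps its quadratic remainder. The linear coefficient is the
    derivative of f, at most 1, and the remainder is multiplied by the positive slope
    [G' (1 - G x)]. *)
Lemma two_copies_gap (x : R) (q : nat -> R) : 0 < x < 1 ->
    minimax_map p x = x -> two_copies_orbit x q ->
  derive1 (minimax_map p) x <= 1 ->
  exists2 k : R, 0 < k & forall n, x - q n.+1 <= x - q n - k * (x - q n) ^+ 2.
Proof.
move=> hx hfx hq; rewrite derive1_minimax_map// => f1.
have Gx01 := offspring_R_gt0_lt1 _ hx; have GGx := offspring_gf_fixed _ hfx.
have [k pk] := exists_branching _ hp hp1.
have a0 : 0 < G' (1 - G x) by apply: offspring_gf'_gt0.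
exists (G' (1 - G x) * (p k.+2 * x ^+ k)).
  by case/andP: hx => x0 x1; rewrite mulr_gt0// mulr_gt0// exprn_gt0.
move=> n; have [/andP[q0 qx] q_inner ->] := hq n; rewrite /two_copies_map.
have x01 : 0 <= x < 1 by lra.
have q01 : 0 <= q n <= 1 by lra.
have := offspring_gf_tangent _ hp _ _ k x01 q01.
set gap := p k.+2 * x ^+ k => Hin.
have Gqx : G (q n) <= G x by apply: offspring_gf_le => //; lra.
have a01 : 0 <= 1 - G x < 1 by lra.
have b01 : 0 <= 1 - 2 * G x + G (q n) <= 1 by lra.
have := offspring_gf_tangent _ hp _ _ 0 a01 b01; rewrite GGx.
set b := 1 - 2 * G x + G (q n).
have : 0 <= p 2%N * (1 - G x) ^+ 0 * (b - (1 - G x)) ^+ 2.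
  by rewrite mulr_ge0 ?sqr_ge0// mulr_ge0// (offspring_ge0 hp).
move=> /le_trans/[apply].
rewrite (_ : b - (1 - G x) = G (q n) - G x); last by rewrite /b; ring.
move=> Hout.
have {}Hin : G' (1 - G x) * (gap * (q n - x) ^+ 2) <=
    G' (1 - G x) * (G (q n) - G x - G' x * (q n - x)) by rewrite ler_pM2l.
have : G' (1 - G x) * G' x * (x - q n) <= x - q n by rewrite ler_piMl// subr_ge0.
rewrite -/b => H.
have -> : (x - q n) ^+ 2 = (q n - x) ^+ 2 by ring.
move: Hin; rewrite -mulrA => Hin.
lra.
Qed.

(** A gap that never fell below [e] would lose at least [k * e ^ 2] at each step and become
    negative. This covers the critical slope 1 as well. *)
Lemma two_copies_to_fixed (x : R) (q : nat -> R) : 0 < x < 1 ->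
    minimax_map p x = x -> two_copies_orbit x q ->
  derive1 (minimax_map p) x <= 1 ->
  forall e : R, 0 < e -> exists n, x - q n < e.
Proof.
move=> hx hfx hq f1 e e0; have [k k0 gap] := two_copies_gap _ _ hx hfx hq f1.
 apply: contrapT => /forallNP no.
have ge_e n : e <= x - q n by rewrite leNgt; apply/negP/no.
have dec n : x - q n <= x - q 0 - n%:R * (k * e ^+ 2).
  elim: n => [|n IH]; first by rewrite mul0r subr0.
  have sq : e ^+ 2 <= (x - q n) ^+ 2 by rewrite lerXn2r// nnegrE ltW// (lt_le_trans e0).
  have := gap n; rewrite -natr1 mulrDl mul1r.
  have : k * e ^+ 2 <= k * (x - q n) ^+ 2 by rewrite ler_pM2l.
  lra.
have ke : 0 < k * e ^+ 2 by rewrite mulr_gt0// exprn_gt0.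
(* After [n + 1] steps the accumulated loss exceeds 1, hence exceeds the initial gap. *)
pose n := Num.truncn ((k * e ^+ 2)^-1).
have := dec n.+1; apply/negP; rewrite -ltNge.
have : 1 < n.+1%:R * (k * e ^+ 2).
  by rewrite -ltr_pdivrMr// mul1r truncnS_gt.
have [q0 _ _] := hq 0%N; have [qn _ _] := hq n.+1; lra.
Qed.

(** A slope above 1 at the fixed point gives h(x - delta) < x - delta for small delta; as h is
    increasing, the orbit cannot cross [x - delta] upwards. *)
Lemma two_copies_away_from_fixed (x : R) (q : nat -> R) : 0 < x < 1 ->
    minimax_map p x = x -> two_copies_orbit x q ->
  q 0%N < x -> 1 < derive1 (minimax_map p) x ->
  exists2 delta : R, 0 < delta & forall n, delta <= x - q n.
Proof.
move=> hx hfx hq q0x; rewrite derive1_minimax_map// => f1.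
have dh := is_derive_two_copies_map _ hx.
have : (fun h => h^-1 *: (two_copies_map x (h *: (1 : R) + x) - two_copies_map x x))
    @ 0^' --> G' (1 - G x) * G' x.
  rewrite -(@derive_val _ _ _ _ _ _ _ dh).
  exact: (@ex_derive _ _ _ _ _ _ _ dh).
move=> /cvgr_gt /(_ _ f1) /nbhs_ballP[eta /= eta0 Heta].
(* The first bound puts [- delta] in the ball where the difference quotient exceeds 1; the second
   puts [q 0] below the barrier. *)
pose delta := Num.min (eta / 2) (x - q 0%N).
have delta0 : 0 < delta by rewrite lt_min divr_gt0//= subr_gt0.
have deta : delta < eta by rewrite gt_min; apply/orP; left; lra.
have dx : delta <= x - q 0%N by rewrite ge_min lexx orbT.
have hd : two_copies_map x (x - delta) < x - delta.
  have := Heta (- delta); rewrite /ball/= sub0r opprK gtr0_norm// => /(_ deta).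
  rewrite oppr_eq0 gt_eqF// => /(_ isT).
  rewrite /GRing.scale/= mulr1 two_copies_map_fixed// [- delta + x]addrC.
  rewrite invrN mulNr -mulrN mulrC ltr_pdivlMr// mul1r; lra.
exists delta => //; elim=> [//|n IH].
have [/andP[qn0 qnx] q_inner q_rec] := hq n.
have le_in : G (q n) <= G (x - delta) by apply: offspring_gf_le => //; lra.
have in1 : G (x - delta) <= G x by apply: offspring_gf_le => //; lra.
have Gx01 := offspring_R_gt0_lt1 _ hx.
have : two_copies_map x (q n) <= two_copies_map x (x - delta).
  rewrite lerD2l; apply: offspring_gf_le => //; lra.
rewrite q_rec; lra.
Qed.

End two_copies_map.

(** * Expectations of unit-valued functions *)

Lemma measurable_fun_nat_index d (T : measurableType d) d' (U : measurableType d')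
    (tau : T -> nat) (F : nat -> T -> U) :
  measurable_fun setT tau -> (forall k, measurable_fun setT (F k)) ->
  measurable_fun setT (fun w => F (tau w) w).
Proof.
move=> mtau mF _ B mB; rewrite setTI.
rewrite (_ : _ @^-1` B = \bigcup_k ((tau @^-1` [set k]) `&` (F k @^-1` B))).
  apply: bigcup_measurable => k _; apply: measurableI.
    by rewrite -[X in measurable X]setTI; exact: mtau.
  by rewrite -[X in measurable X]setTI; exact: mF.
by apply/seteqP; split => [w Bw|w [k _ [/= <-]]//]; exists (tau w).
Qed.

Section unit_valued.
Context {d} {Omega : measurableType d} {R : realType} (P : probability Omega R).

(** This class is closed under products and complements and consists of integrable functions, so
    means can be handled as plain real numbers. *)
Definition unit_valued (g : Omega -> R) : Prop :=
  measurable_fun setT g /\ forall w, 0 <= g w <= 1.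

Local Notation mean g := (Rintegral P setT g).

Lemma unit_valued_integrable (g : Omega -> R) : unit_valued g ->
  P.-integrable setT (EFin \o g).
Proof.
move=> [mg g01]; apply: measurable_bounded_integrable => //.
  by rewrite -ge0_fin_numE ?fin_num_measure.
exists 1; split; first exact: num_real.
move=> M M1 w _ /=; have /andP[g0 g1] := g01 w.
by rewrite ger0_norm// (le_trans g1)// ltW.
Qed.

Lemma unit_valuedM (f g : Omega -> R) : unit_valued f -> unit_valued g ->
  unit_valued (fun w => f w * g w).
Proof.
move=> [mf f01] [mg g01]; split; first exact: measurable_funM.
move=> w; have /andP[f0 f1] := f01 w; have /andP[g0 g1] := g01 w.
by rewrite mulr_ge0// mulr_ile1.
Qed.

Lemma unit_valued_onem (f : Omega -> R) : unit_valued f ->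
  unit_valued (fun w => 1 - f w).
Proof.
move=> [mf f01]; split; first exact: measurable_funB.
by move=> w; have /andP[f0 f1] := f01 w; rewrite subr_ge0 f1 gerBl.
Qed.

Lemma unit_valued_bool (b : Omega -> bool) : measurable_fun setT b ->
  unit_valued (fun w => (b w)%:R).
Proof.
move=> mb; split.
  have mR : measurable_fun setT (fun b : bool => b%:R : R) by [].
  exact: measurableT_comp mR mb.
by move=> w; case: (b w); rewrite ?lexx ?ler01.
Qed.

Lemma unit_valued_cst (r : R) : 0 <= r <= 1 -> unit_valued (fun=> r).
Proof. by move=> r01; split=> //; exact: measurable_cst. Qed.

Lemma unit_valued_prod (I : Type) (s : seq I) (f : I -> Omega -> R) :
  (forall i, unit_valued (f i)) -> unit_valued (fun w => \prod_(i <- s) f i w).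
Proof.
move=> uf; elim: s => [|i s IH].
  under eq_fun do rewrite big_nil; by apply: unit_valued_cst; rewrite ler01 lexx.
by under eq_fun do rewrite big_cons; exact: unit_valuedM.
Qed.

Lemma meanD (f g : Omega -> R) : unit_valued f -> unit_valued g ->
  mean (fun w => f w + g w) = mean f + mean g.
Proof. by move=> uf ug; rewrite RintegralD//; exact: unit_valued_integrable. Qed.

Lemma meanB (f g : Omega -> R) : unit_valued f -> unit_valued g ->
  mean (fun w => f w - g w) = mean f - mean g.
Proof. by move=> uf ug; rewrite RintegralB//; exact: unit_valued_integrable. Qed.

Lemma mean_cst (r : R) : mean (fun=> r) = r.
Proof. by rewrite Rintegral_cst// [fine _](congr1 fine (probability_setT P)) mulr1. Qed.

Lemma mean_le (f g : Omega -> R) : unit_valued f -> unit_valued g ->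
  (forall w, f w <= g w) -> mean f <= mean g.
Proof.
by move=> uf ug fg; apply: le_Rintegral => //; exact: unit_valued_integrable.
Qed.

Lemma mean_leD (f g h : Omega -> R) :
  unit_valued f -> unit_valued g -> unit_valued h ->
  (forall w, f w <= g w + h w) -> mean f <= mean g + mean h.
Proof.
move=> uf ug uh fgh; rewrite -meanD//; apply: le_Rintegral => //.
  exact: unit_valued_integrable.
exact: (integrableD measurableT (unit_valued_integrable _ ug) (unit_valued_integrable _ uh)).
Qed.

Lemma mean_bounds (f : Omega -> R) : unit_valued f -> 0 <= mean f <= 1.
Proof.
move=> uf; have [mf f01] := uf; apply/andP; split.
  by apply: Rintegral_ge0 => w _; case/andP: (f01 w).
rewrite -[leRHS]mean_cst; apply: mean_le => //.
  by apply: unit_valued_cst; rewrite ler01 lexx.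
by move=> w; case/andP: (f01 w).
Qed.

Lemma mean_bool (A : set Omega) : measurable A ->
  mean (fun w => (w \in A)%:R) = fine (P A).
Proof. by move=> mA; rewrite /Rintegral integral_indic// setIT. Qed.

Lemma unit_valued_set (A : set Omega) : measurable A ->
  unit_valued (fun w => (w \in A)%:R).
Proof.
move=> mA; apply: unit_valued_bool; apply: (measurable_fun_bool true).
rewrite setTI (_ : _ @^-1` _ = A)//; apply/funext => w; apply/propext.
split=> [wA|Aw]; [exact: (set_mem wA)|exact: (mem_set Aw)].
Qed.

Lemma unit_valued_if (A : set Omega) (f g : Omega -> R) : measurable A ->
  unit_valued f -> unit_valued g ->
  unit_valued (fun w => if w \in A then f w else g w).
Proof.
move=> mA uf ug; have uA := unit_valued_set _ mA; split.
  rewrite (_ : (fun w => _) =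
      fun w => (w \in A)%:R * f w + (1 - (w \in A)%:R) * g w); last first.
    by apply/funext => w; case: (w \in A) => /=; ring.
  apply: measurable_funD; apply: (unit_valuedM _ _ _ _).1 => //.
  exact: unit_valued_onem.
by move=> w; case: ifP => _; [exact: uf.2|exact: ug.2].
Qed.

Lemma measurable_fun_nat_eq (tau : Omega -> nat) (k : nat) :
  measurable_fun setT tau -> measurable_fun setT (fun w => tau w == k).
Proof.
have mk : measurable_fun setT (fun n : nat => n == k) by [].
by move=> mt; exact: measurableT_comp mk mt.
Qed.

(** Stands in for conditioning on a discrete variable: the partial sums are the means of [g] on
    [tau < n], and dominated convergence applies. *)
Lemma mean_partition (tau : Omega -> nat) (g : Omega -> R) :
  measurable_fun setT tau -> unit_valued g ->
  series (fun k => mean (fun w => g w * (tau w == k)%:R)) @ \oo --> mean g.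
Proof.
move=> mtau ug; have [mg g01] := ug.
have mlt n : measurable_fun setT (fun w => (tau w < n)%N).
  have mn : measurable_fun setT (fun m : nat => (m < n)%N) by [].
  exact: measurableT_comp mn mtau.
have ult n := unit_valuedM _ _ ug (unit_valued_bool _ (mlt n)).
have -> : series (fun k => mean (fun w => g w * (tau w == k)%:R)) =
    fun n => mean (fun w => g w * (tau w < n)%N%:R).
  apply/funext; elim => [|n IH].
    rewrite seriesEnat/= big_geq//.
    by rewrite -[LHS]mean_cst; apply: eq_Rintegral => w _; rewrite mulr0.
  rewrite seriesSr IH -meanD//; last first.
    by apply: unit_valuedM => //; apply: unit_valued_bool; exact: measurable_fun_nat_eq.
  apply: eq_Rintegral => w _; rewrite -mulrDr; congr (_ * _); rewrite ltnS.
  by case: ltngtP => _; rewrite ?addr0 ?add0r.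
apply: fine_cvg; rewrite fineK; last exact/integrable_fin_num/unit_valued_integrable.
have mE n : measurable_fun setT (EFin \o (fun w => g w * (tau w < n)%N%:R)).
  by apply/measurable_EFinP; exact: (ult n).1.
have mgE : measurable_fun setT (EFin \o g) by apply/measurable_EFinP.
have cg : {ae P, forall w, setT w ->
    (fun n => (g w * (tau w < n)%N%:R)%:E) @ \oo --> (g w)%:E}.
  apply: aeW => w _; apply: cvg_near_cst; exists (tau w).+1 => // n /= tn.
  by rewrite tn mulr1.
have dom : {ae P, forall w n, setT w ->
    (`|(g w * (tau w < n)%N%:R)%:E| <= (g w)%:E)%E}.
  apply: aeW => w n _ /=; have /andP[g0 _] := g01 w.
  by rewrite lee_fin ger0_norm ?mulr_ge0// ler_piMr//; case: (_ < _)%N.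
by have [] := dominated_convergence measurableT mE mgE cg
  (unit_valued_integrable _ ug) dom.
Qed.

End unit_valued.

(** * Moments of the conditional root law *)

(** S(v) of the overview, computed from the [m] levels below [v] when the nodes [m] levels down
    attain their distinguished value independently with probability [y]. *)
Fixpoint nand_value {R : realType} (y : R) (c : node -> nat) (m : nat) (v : node) : R :=
  if m is m'.+1 then \prod_(i < c v) (1 - nand_value y c m' (nat_of_ord i :: v))
  else y.

Lemma nand_value_bounds (R : realType) (y : R) (c : node -> nat) m v :
  0 <= y <= 1 -> 0 <= nand_value y c m v <= 1.
Proof.
move=> y01; elim: m v => [//|m IH] v /=.
have h (i : 'I_(c v)) : 0 <= 1 - nand_value y c m (nat_of_ord i :: v) <= 1.
  by have := IH (nat_of_ord i :: v); lra.
rewrite prodr_ge0 => [|i _]; last by case/andP: (h i).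
by rewrite prodr_ile1.
Qed.

Definition subtree (v : node) : set node := [set u | suffix v u].

Lemma subtree_child (i : nat) (v : node) : subtree (i :: v) `<=` subtree v.
Proof. by move=> u; apply: suffix_trans; exact: suffix_cons. Qed.

Lemma subtree_children (i j : nat) (v u : node) :
  subtree (i :: v) u -> subtree (j :: v) u -> i = j.
Proof.
by rewrite /subtree/= !suffixE/= => /eqP -> /eqP[].
Qed.

Section moments.
Context {d} {Omega : measurableType d} {R : realType} (P : probability Omega R).
Variables (p : nat -> R) (N : node -> Omega -> nat).
Hypothesis hp : offspring_distribution p.
Hypothesis hN : galton_watson P p N.

Local Notation mean g := (Rintegral P setT g).
Local Notation G := (offspring_gf p).

Definition offspring_event (s : seq (node * nat)) (w : Omega) : bool :=
  all (fun x => N x.1 w == x.2) s.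

Lemma measurable_offspring_event s : measurable_fun setT (offspring_event s).
Proof.
elim: s => [|v s IH]; first exact: measurable_cst.
by apply: measurable_and => //; exact/measurable_fun_nat_eq/(gw_measurable hN).
Qed.

(** Weaker than independence: only the conditional mean of [Phi] given the offspring numbers in [D]
    has to be constant. This is what the induction over the tree can carry along. *)
Definition independent_of_offspring (D : set node) (Phi : Omega -> R) : Prop :=
  forall s : seq (node * nat), uniq (unzip1 s) -> (forall x, x \in s -> D x.1) ->
    mean (fun w => Phi w * (offspring_event s w)%:R) =
    mean Phi * \prod_(x <- s) p x.2.

Lemma independent_of_offspring1 D : independent_of_offspring D (fun=> 1).
Proof.
move=> s us _; rewrite mean_cst mul1r.
(* Turns the list of prescriptions into the function that [gw_iid] expects; [uniq] makes it
   unambiguous, and the default 0 is only reached off the list. *)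
pose k v := nth 0%N (unzip2 s) (index v (unzip1 s)).
have kE x : x \in s -> k x.1 = x.2.
  move=> xs; rewrite /k; have/(nthP x)[i ilt <-] := xs.
  rewrite -(nth_map x ([::] : node))// index_uniq ?size_map//.
  by rewrite (nth_map x).
have -> : (fun w => 1 * (offspring_event s w)%:R) =
    (fun w => (w \in [set w | forall v, v \in unzip1 s -> N v w = k v])%:R) :> (_ -> R).
  apply/funext => w; rewrite mul1r; congr (_%:R); congr nat_of_bool.
  apply/idP/idP.
    by move=> /allP h; apply/mem_set => v /mapP[x xs ->]; rewrite kE//; apply/eqP/h.
  by move=> /set_mem h; apply/allP => x xs; rewrite h ?kE//; exact: map_f.
rewrite mean_bool ?(gw_iid hN)//=; last first.
  rewrite (_ : mkset _ = \bigcap_(v in [set` unzip1 s]) (N v @^-1` [set k v])).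
    apply: fin_bigcap_measurable => [|v _]; first exact: finite_seq.
    by rewrite -[X in measurable X]setTI; exact: (gw_measurable hN).
  by apply/seteqP; split => w h v vs; exact: h.
by rewrite big_map big_seq [RHS]big_seq; apply: eq_bigr => x xs; rewrite kE.
Qed.

Lemma offspring_event_cat s s' w :
  offspring_event (s ++ s') w = offspring_event s w && offspring_event s' w.
Proof. exact: all_cat. Qed.

Lemma mean_restrict_event (D D' : set node) Phi s :
  independent_of_offspring D Phi -> uniq (unzip1 s) ->
  (forall x, x \in s -> D x.1 /\ ~ D' x.1) -> D' `<=` D ->
  independent_of_offspring D' (fun w => Phi w * (offspring_event s w)%:R).
Proof.
move=> ind us sD DD t ut tD.
rewrite (ind s)//; last by move=> x /sD[].
rewrite -mulrA -big_cat/= -ind.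
- by apply: eq_Rintegral => w _; rewrite offspring_event_cat -mulnb natrM mulrA.
- rewrite /unzip1 map_cat cat_uniq us ut andbT/=; apply/hasPn => v /mapP[x xt ->].
  apply/negP => /mapP[y ys xy].
  by have [_] := sD _ ys; apply; rewrite -xy; exact: tD.
- by move=> x; rewrite mem_cat => /orP[/sD[]//|/tD/DD].
Qed.

Section children.
Variables (g : nat -> Omega -> R) (r : R) (v : node).
Hypothesis ug : forall i, unit_valued (g i).
Hypothesis mean_g : forall i Psi, unit_valued Psi ->
  independent_of_offspring (subtree (i :: v)) Psi ->
  mean (fun w => Psi w * g i w) = mean Psi * r.

(** Children are peeled off from the last one. The event [s] on the subtrees of the children from
    [k] on strengthens the induction: it says exactly that the product over the earlier children
    does not correlate with the subtree of child [k], as [mean_g] requires. *)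
Lemma mean_prod_children Phi (k : nat) : unit_valued Phi ->
  independent_of_offspring [set u | exists i, subtree (i :: v) u] Phi ->
  forall s, uniq (unzip1 s) ->
  (forall x, x \in s -> exists2 i, (k <= i)%N & subtree (i :: v) x.1) ->
  mean (fun w => Phi w * \prod_(i < k) g i w * (offspring_event s w)%:R) =
  mean Phi * r ^+ k * \prod_(x <- s) p x.2.
Proof.
move=> uPhi ind; elim: k => [|k IH] s us hs.
  rewrite expr0 mulr1 -ind//; last by move=> x /hs[i _ ?]; exists i.
  by apply: eq_Rintegral => w _; rewrite big_ord0 mulr1.
have uPsi : unit_valued (fun w => Phi w * \prod_(i < k) g i w * (offspring_event s w)%:R).
  apply: unit_valuedM; last exact/unit_valued_bool/measurable_offspring_event.
  by apply: unit_valuedM => //; apply: unit_valued_prod => i; exact: ug.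
transitivity (mean (fun w =>
  Phi w * \prod_(i < k) g i w * (offspring_event s w)%:R * g k w)).
  by apply: eq_Rintegral => w _; rewrite big_ord_recr/=; ring.
rewrite mean_g//.
  rewrite IH// ?exprSr; first by ring.
  by move=> x /hs[i ki ?]; exists i => //; exact: ltnW.
move=> t ut ht; rewrite IH//; last first.
  by move=> x /hs[i ki ?]; exists i => //; exact: ltnW.
rewrite -mulrA -big_cat/= -IH.
- apply: eq_Rintegral => w _; rewrite offspring_event_cat -mulnb natrM; ring.
- rewrite /unzip1 map_cat cat_uniq us ut andbT/=; apply/hasPn => u /mapP[x xt ->].
  apply/negP => /mapP[y ys xy]; have [i ki] := hs _ ys.
  rewrite -xy => /subtree_children/(_ (ht _ xt)) ik.
  by rewrite ik ltnn in ki.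
- move=> x; rewrite mem_cat => /orP[/hs[i ki ?]|/ht ?]; last by exists k.
  by exists i => //; exact: ltnW.
Qed.

End children.


Fixpoint nand_mean (y : R) (m : nat) : R :=
  if m is m'.+1 then G (1 - nand_mean y m') else y.

Fixpoint nand_sqmean (y : R) (m : nat) : R :=
  if m is m'.+1 then G (1 - 2 * nand_mean y m' + nand_sqmean y m') else y ^+ 2.

Lemma measurable_nand_value (y : R) (m : nat) (v : node) :
  measurable_fun setT (fun w => nand_value y (N ^~ w) m v).
Proof.
elim: m v => [|m IH] v; first exact: measurable_cst.
pose F k w := \prod_(i < k) (1 - nand_value y (N ^~ w) m (nat_of_ord i :: v)).
apply: (measurable_fun_nat_index _ _ _ _ (N v) F); first exact: (gw_measurable hN).
by move=> k; apply: measurable_prod => i _; apply: measurable_funB.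
Qed.

Lemma unit_valued_nand_value (y : R) (m : nat) (v : node) : 0 <= y <= 1 ->
  unit_valued (fun w => nand_value y (N ^~ w) m v).
Proof.
move=> y01; split; first exact: measurable_nand_value.
by move=> w; exact: nand_value_bounds.
Qed.

(** Split according to [N v = k]: this event concerns [v] alone, which lies in no subtree of a
    child, so [Phi] restricted to it can be fed to [mean_prod_children]. The terms are [p k * r ^ k]
    times the mean of [Phi]. *)
Lemma mean_nand_value_step (h : nat -> Omega -> R) (r : R) (v : node) Phi :
  (forall i, unit_valued (h i)) ->
  (forall i Psi, unit_valued Psi ->
    independent_of_offspring (subtree (i :: v)) Psi ->
    mean (fun w => Psi w * h i w) = mean Psi * r) ->
  unit_valued Phi -> independent_of_offspring (subtree v) Phi ->
  mean (fun w => Phi w * \prod_(i < N v w) h i w) = mean Phi * G r.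
Proof.
move=> uh mh uPhi ind.
have u1 : unit_valued (fun _ : Omega => 1 : R) by apply: unit_valued_cst; rewrite ler01 lexx.
(* Taking [Psi = 1] shows that [r] is itself a mean, so the series of G converges at [r]. *)
have r01 : 0 <= r <= 1.
  have := mh 0%N _ u1 (independent_of_offspring1 _); rewrite mean_cst mul1r => <-.
  by apply: mean_bounds; apply: unit_valuedM.
have uprod : unit_valued (fun w => \prod_(i < N v w) h i w).
  split.
    apply: (measurable_fun_nat_index _ _ _ _ (N v) (fun k w => \prod_(i < k) h i w)).
      exact: (gw_measurable hN).
    by move=> k; apply: measurable_prod => i _; exact: (uh i).1.
  move=> w; rewrite prodr_ge0 => [|i _]; last by case/andP: ((uh i).2 w).
  by rewrite prodr_ile1// => i _; exact: (uh i).2.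
have := mean_partition P _ _ (gw_measurable hN v) (unit_valuedM _ _ uPhi uprod).
have -> : (fun k => mean (fun w => Phi w * \prod_(i < N v w) h i w * (N v w == k)%:R)) =
    mean Phi *: (fun k => p k * r ^+ k).
  apply/funext => k; rewrite fctE.
  transitivity (mean (fun w => Phi w * (offspring_event [:: (v, k)] w)%:R *
      \prod_(i < k) h i w * (offspring_event [::] w)%:R)).
    apply: eq_Rintegral => w _; rewrite /= andbT mulr1.
    by case: eqP => [->|_]; rewrite ?mulr0 ?mul0r ?mulr1.
  rewrite (@mean_prod_children _ _ _ uh mh)//.
  - rewrite big_nil mulr1 ind//; first by rewrite big_seq1 -mulrA.
    by move=> x; rewrite inE => /eqP ->; exact: suffix_refl.
  - by apply: unit_valuedM => //; apply: unit_valued_bool; exact: measurable_offspring_event.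
  apply: (mean_restrict_event _ _ _ _ ind) => //.
    move=> x; rewrite inE => /eqP -> /=; split; first exact: suffix_refl.
    by move=> [i]; rewrite /subtree/= => /size_suffix; rewrite /= ltnn.
  by move=> u [i]; exact: subtree_child.
move=> cs; rewrite -(cvg_lim _ cs)//.
have cG : cvgn (series (fun k => p k * r ^+ k)) by apply: is_cvg_offspring_gf.
by rewrite lim_seriesZ.
Qed.

(** The general factor [Phi] is needed for the induction, where it stands for the siblings already
    treated. Both moments go together because E[(1 - S)^2] involves the first one. *)
Lemma mean_nand_value (y : R) (m : nat) (v : node) Phi : 0 <= y <= 1 ->
  unit_valued Phi -> independent_of_offspring (subtree v) Phi ->
  mean (fun w => Phi w * nand_value y (N ^~ w) m v) = mean Phi * nand_mean y m /\
  mean (fun w => Phi w * nand_value y (N ^~ w) m v ^+ 2) =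
    mean Phi * nand_sqmean y m.
Proof.
move=> y01; elim: m v Phi => [|m IH] v Phi uPhi ind.
  have uy : unit_valued (fun _ : Omega => y) by exact: unit_valued_cst.
  split => /=; rewrite RintegralZr//; exact: unit_valued_integrable.
have uS u := unit_valued_nand_value y m u y01.
have uS1 u := unit_valued_onem _ (uS u).
split => /=.
  apply: (mean_nand_value_step (fun i w => 1 - nand_value y (N ^~ w) m (i :: v))) => //.
  move=> i Psi uPsi indPsi.
  rewrite mulrBr mulr1 -(proj1 (IH _ _ uPsi indPsi)) -meanB//; last exact: unit_valuedM.
  by apply: eq_Rintegral => w _; rewrite mulrBr mulr1.
transitivity (mean (fun w => Phi w * \prod_(i < N v w)
    (1 - nand_value y (N ^~ w) m (nat_of_ord i :: v)) ^+ 2)).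
  by apply: eq_Rintegral => w _; rewrite prodrXl.
apply: (mean_nand_value_step (fun i w => (1 - nand_value y (N ^~ w) m (i :: v)) ^+ 2)) => //.
  by move=> i; under eq_fun do rewrite expr2; exact: unit_valuedM.
move=> i Psi uPsi indPsi.
have [m1 m2] := IH _ _ uPsi indPsi.
have u1 := unit_valuedM _ _ uPsi (uS (i :: v)).
have u2 : unit_valued (fun w => Psi w * nand_value y (N ^~ w) m (i :: v) ^+ 2).
  under eq_fun do rewrite expr2 mulrA; exact: unit_valuedM.
have u3 := unit_valuedM _ _ uPsi (uS1 (i :: v)).
have -> : mean Psi * (1 - 2 * nand_mean y m + nand_sqmean y m) =
    mean Psi - mean Psi * nand_mean y m - (mean Psi * nand_mean y m - mean Psi * nand_sqmean y m).
  by ring.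
rewrite -m1 -m2 -!meanB//.
- by apply: eq_Rintegral => w _; ring.
- rewrite (_ : (fun w => _) = fun w => Psi w * (1 - nand_value y (N ^~ w) m (i :: v)))//.
  by apply/funext => w; ring.
- rewrite (_ : (fun w => _) = fun w => Psi w * nand_value y (N ^~ w) m (i :: v) *
      (1 - nand_value y (N ^~ w) m (i :: v))); first exact: unit_valuedM.
  by apply/funext => w; ring.
Qed.

Lemma mean_nand_root (y : R) (m : nat) : 0 <= y <= 1 ->
  mean (fun w => nand_value y (N ^~ w) m [::]) = nand_mean y m.
Proof.
move=> y01; have u1 : unit_valued (fun _ : Omega => 1 : R).
  by apply: unit_valued_cst; rewrite ler01 lexx.
have [+ _] := mean_nand_value _ m _ _ y01 u1 (independent_of_offspring1 (subtree [::])).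
by rewrite mean_cst mul1r => <-; apply: eq_Rintegral => w _; rewrite mul1r.
Qed.

Lemma mean_sq_nand_root (y : R) (m : nat) : 0 <= y <= 1 ->
  mean (fun w => nand_value y (N ^~ w) m [::] ^+ 2) = nand_sqmean y m.
Proof.
move=> y01; have u1 : unit_valued (fun _ : Omega => 1 : R).
  by apply: unit_valued_cst; rewrite ler01 lexx.
have [_] := mean_nand_value _ m _ _ y01 u1 (independent_of_offspring1 (subtree [::])).
by rewrite mean_cst mul1r => <-; apply: eq_Rintegral => w _; rewrite mul1r.
Qed.

End moments.

(** * The tree up to a given level *)

Lemma tree_upto_finite (c : node -> nat) (m : nat) : finite_set (tree_upto c m).
Proof.
elim: m => [|m IH].
  apply: (sub_finite_set _ (finite_set1 ([::] : node))).
  by move=> [|i v]// [].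
apply: (@sub_finite_set _ _ (tree_upto c m `|`
    \bigcup_(v in tree_upto c m) ((fun i : nat => i :: v) @` `I_(c v)))).
  move=> [|i v] [/= tv sv]; first by left.
  by move: tv => /andP[ic tv]; right; exists v; [split|exists i].
rewrite finite_setU; split=> //; apply: bigcup_finite => // v _.
by apply: finite_image; exact: finite_II.
Qed.

(** Children are numbered consecutively from 0, so the set of words determines how many there
    are. *)
Lemma tree_upto_eq_offspring (c c' : node -> nat) (m : nat) :
  tree_upto c m = tree_upto c' m ->
  forall v, in_tree c v -> (size v < m)%N -> c v = c' v.
Proof.
move=> cc' v tv sv.
have t'v : in_tree c' v.
  have : tree_upto c m v by split=> //; exact: ltnW.
  by rewrite cc' => -[].
have lt_iff i : (i < c v)%N <-> (i < c' v)%N.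
  have : tree_upto c m (i :: v) <-> tree_upto c' m (i :: v) by rewrite cc'.
  by rewrite /tree_upto/= tv t'v !andbT => -[h1 h2]; split=> h; [case: h1|case: h2].
apply/eqP; rewrite eqn_leq; apply/andP; split; rewrite leqNgt; apply/negP.
  by move/lt_iff; rewrite ltnn.
by move/lt_iff; rewrite ltnn.
Qed.

Lemma tree_upto_leq (c c' : node -> nat) (m n : nat) : (m <= n)%N ->
  tree_upto c n = tree_upto c' n -> tree_upto c m = tree_upto c' m.
Proof.
move=> mn cc'; apply/seteqP; split => v [tv sv].
  have : tree_upto c n v by split=> //; exact: leq_trans mn.
  by rewrite cc' => -[].
have : tree_upto c' n v by split=> //; exact: leq_trans mn.
by rewrite -cc' => -[].
Qed.

Lemma nand_value_tree_upto {R : realType} (y : R) (c c' : node -> nat) (m : nat) :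
  tree_upto c m = tree_upto c' m ->
  forall j v, in_tree c v -> (size v + j <= m)%N ->
  nand_value y c j v = nand_value y c' j v.
Proof.
move=> cc'; elim=> [//|j IH] v tv; rewrite addnS => sv /=.
have cv : c v = c' v.
  apply: (tree_upto_eq_offspring _ _ _ cc') => //.
  by apply: leq_trans sv; rewrite ltnS leq_addr.
rewrite -cv; apply: eq_bigr => i _; congr (1 - _); apply: IH; first by rewrite /= ltn_ord.
by rewrite /= addSn.
Qed.

(** Finite sets of words are countable, so the truncated tree becomes a natural number to which
    [mean_partition] applies. *)
Definition tree_code (c : node -> nat) (m : nat) : nat :=
  choice.pickle (fset_set (tree_upto c m)).

Lemma tree_codeP (c c' : node -> nat) (m : nat) :
  tree_code c m = tree_code c' m <-> tree_upto c m = tree_upto c' m.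
Proof.
split=> [/(pcan_inj choice.pickleK) h|h]; last by rewrite /tree_code h.
by rewrite -(fset_setK (tree_upto_finite c m)) h fset_setK//; exact: tree_upto_finite.
Qed.

Section tree_determined.
Context {d} {Omega : measurableType d} (N : node -> Omega -> nat).
Hypothesis mN : forall v, measurable_fun setT (N v).

(** Measurability is not demanded: such a set is a union of at most countably many classes of equal
    truncated tree, each in [tree_sigma_algebra]. *)
Definition tree_determined (m : nat) (B : set Omega) : Prop :=
  forall w w', tree_upto (N ^~ w) m = tree_upto (N ^~ w') m -> B w -> B w'.

Lemma measurable_in_tree (v : node) : measurable [set w | in_tree (N ^~ w) v].
Proof.
elim: v => [|i v IH] /=.
  by rewrite (_ : mkset _ = setT)//; apply/seteqP; split.
rewrite (_ : mkset _ = N v @^-1` [set k | (i < k)%N] `&` [set w | in_tree (N ^~ w) v]).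
  by apply: measurableI => //; rewrite -[X in measurable X]setTI; exact: mN.
by apply/seteqP; split=> w /= => [/andP[]|[-> ->]].
Qed.

Lemma tree_sigma_algebra_sub (A : set Omega) : tree_sigma_algebra N A -> measurable A.
Proof.
move=> tA; apply: (tA (@measurable _ Omega)); split.
  exact: sigma_algebra_measurable.
by move=> _ [v ->]; exact: measurable_in_tree.
Qed.

Let sigma_alg : sigma_algebra setT (tree_sigma_algebra N) := @smallest_sigma_algebra _ _ _.

Lemma tree_sigma_algebraC (A : set Omega) :
  tree_sigma_algebra N A -> tree_sigma_algebra N (~` A).
Proof. by case: sigma_alg => _ h _ /h; rewrite setTD. Qed.

Lemma tree_sigma_algebra_bigcup (F : nat -> set Omega) :
  (forall k, tree_sigma_algebra N (F k)) -> tree_sigma_algebra N (\bigcup_k F k).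
Proof. by case: sigma_alg => _ _; exact. Qed.

Lemma tree_sigma_algebra_bigcap (F : nat -> set Omega) :
  (forall k, tree_sigma_algebra N (F k)) -> tree_sigma_algebra N (\bigcap_k F k).
Proof.
move=> mF; rewrite -[X in tree_sigma_algebra N X]setCK setC_bigcap.
apply: tree_sigma_algebraC; apply: tree_sigma_algebra_bigcup => k.
by apply: tree_sigma_algebraC; exact: mF.
Qed.

Lemma tree_sigma_algebra0 : tree_sigma_algebra N set0.
Proof. by case: sigma_alg. Qed.

Lemma tree_sigma_algebra_upto (m : nat) (t : set node) :
  tree_sigma_algebra N [set w | tree_upto (N ^~ w) m = t].
Proof.
rewrite (_ : mkset _ = \bigcap_k
   [set w | if choice.unpickle k is Some v
            then tree_upto (N ^~ w) m v <-> t v else True]).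
  apply: tree_sigma_algebra_bigcap => k; case: (choice.unpickle k) => [v|]; last first.
    rewrite (_ : mkset _ = setT)//; rewrite -setC0.
    by apply: tree_sigma_algebraC; exact: tree_sigma_algebra0.
  have Tv : tree_sigma_algebra N [set w | tree_upto (N ^~ w) m v].
    case: (leqP (size v) m) => sv.
      rewrite (_ : mkset _ = [set w | in_tree (N ^~ w) v]).
        by move=> M [_]; apply; exists v.
      by apply/seteqP; split=> w; [case|split].
    rewrite (_ : mkset _ = set0); first exact: tree_sigma_algebra0.
    by apply/seteqP; split=> w// -[_]; rewrite leqNgt sv.
  have [tv|tv] := pselect (t v).
    rewrite (_ : mkset _ = [set w | tree_upto (N ^~ w) m v])//.
    by apply/seteqP; split=> w /=; tauto.
  rewrite (_ : mkset _ = ~` [set w | tree_upto (N ^~ w) m v]).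
    exact: tree_sigma_algebraC.
  by apply/seteqP; split=> w /=; tauto.
apply/seteqP; split=> [w /= <- k _ //|w h] /=.
by apply/seteqP; split=> v; have := h (choice.pickle v) Logic.I;
  rewrite /mkset choice.pickleK; tauto.
Qed.

Lemma tree_determined_sigma_algebra (m : nat) (B : set Omega) :
  tree_determined m B -> tree_sigma_algebra N B.
Proof.
move=> detB.
rewrite (_ : B = \bigcup_k (B `&` [set w | tree_code (N ^~ w) m = k])).
  apply: tree_sigma_algebra_bigcup => k.
  have [[w [Bw wk]]|no] := pselect (exists w, B w /\ tree_code (N ^~ w) m = k).
    rewrite (_ : _ `&` _ = [set w' | tree_upto (N ^~ w') m = tree_upto (N ^~ w) m]).
      exact: tree_sigma_algebra_upto.
    apply/seteqP; split=> w' /=.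
      by move=> [Bw' w'k]; apply/tree_codeP; rewrite w'k.
    by move=> ww'; split; [exact: detB Bw|rewrite -wk; apply/tree_codeP].
  rewrite (_ : _ `&` _ = set0); first exact: tree_sigma_algebra0.
  by apply/seteqP; split=> // w [Bw wk]; apply: no; exists w.
by apply/seteqP; split=> [w Bw|w [k _ []]]//; exists (tree_code (N ^~ w) m).
Qed.

Lemma tree_determined_measurable (m : nat) (B : set Omega) :
  tree_determined m B -> measurable B.
Proof. by move=> /tree_determined_sigma_algebra/tree_sigma_algebra_sub. Qed.

Lemma tree_determined_leq (m n : nat) (B : set Omega) : (m <= n)%N ->
  tree_determined m B -> tree_determined n B.
Proof. by move=> mn h w w' /(tree_upto_leq _ _ _ _ mn); exact: h. Qed.

Lemma measurable_tree_code (m : nat) :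
  measurable_fun setT (fun w => tree_code (N ^~ w) m).
Proof.
move=> _ B _; rewrite setTI; apply: (tree_determined_measurable m).
by move=> w w' /tree_codeP; rewrite /preimage/= => ->.
Qed.

End tree_determined.

(** * The conditional law of the root given the tree *)

Lemma bigmax_binary {R : realType} (n : nat) (F : 'I_n -> R) :
  (forall i, F i = 0 \/ F i = 1) ->
  (\big[Num.max/0]_(i < n) F i = 0 \/ \big[Num.max/0]_(i < n) F i = 1) /\
  (\big[Num.max/0]_(i < n) F i == 0)%:R = \prod_(i < n) (1 - (F i == 1)%:R) :> R.
Proof.
move=> F01; elim/big_rec2: _ => [|i y a _ [a01 ay]]; first by rewrite eqxx; split; [left|].
by case: (F01 i) => ->; case: a01 ay => -> <-;
  rewrite ?maxxx ?(max_r ler01) ?(max_l ler01) ?eqxx ?oner_eq0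
    ?[0 == 1]eq_sym ?oner_eq0 ?subr0 ?subrr ?mul0r ?mul1r;
  split => //; (by left) || by right.
Qed.

Lemma bigmin_binary {R : realType} (n : nat) (F : 'I_n -> R) :
  (forall i, F i = 0 \/ F i = 1) ->
  (\big[Num.min/1]_(i < n) F i = 0 \/ \big[Num.min/1]_(i < n) F i = 1) /\
  (\big[Num.min/1]_(i < n) F i == 1)%:R = \prod_(i < n) (1 - (F i == 0)%:R) :> R.
Proof.
move=> F01; elim/big_rec2: _ => [|i y a _ [a01 ay]]; first by rewrite eqxx; split; [right|].
by case: (F01 i) => ->; case: a01 ay => -> <-;
  rewrite ?minxx ?(min_r ler01) ?(min_l ler01) ?eqxx ?oner_eq0
    ?[0 == 1]eq_sym ?oner_eq0 ?subr0 ?subrr ?mul0r ?mul1r;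
  split => //; (by left) || by right.
Qed.

Lemma ae_all_nodes d (T : measurableType d) (R : realType) (P : probability T R)
    (Q : T -> node -> Prop) :
  (forall v, {ae P, forall w, Q w v}) -> {ae P, forall w, forall v, Q w v}.
Proof.
move=> aeQ.
pose node_of k : node := odflt [::] (choice.unpickle k).
have node_ofK v : node_of (choice.pickle v) = v by rewrite /node_of choice.pickleK.
apply: filterS (ae_foralln (fun k => aeQ (node_of k))) => w h v.
by rewrite -[v]node_ofK; exact: h.
Qed.

Lemma ae_eq_mean d (T : measurableType d) (R : realType) (P : probability T R)
    (f g : T -> R) : unit_valued f -> unit_valued g ->
  {ae P, forall w, f w = g w} -> Rintegral P setT f = Rintegral P setT g.
Proof.
move=> uf ug fg; congr fine; apply: ae_eq_integral => //.
- by apply/measurable_EFinP; exact: uf.1.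
- by apply/measurable_EFinP; exact: ug.1.
- by apply: filterS fg => w /= -> _.
Qed.

Section inclusion_exclusion.
Context {d} {T : measurableType d} {R : realType} (P : probability T R).
Variables (I : eqType) (h : I -> T -> R) (a : I -> R) (D : I -> Prop).
Variable Phi : T -> R.
Hypothesis uh : forall i, unit_valued (h i).
Hypothesis uPhi : unit_valued Phi.
Hypothesis mean_h : forall s, uniq s -> (forall i, i \in s -> D i) ->
  Rintegral P setT (fun w => Phi w * \prod_(i <- s) h i w) =
  Rintegral P setT Phi * \prod_(i <- s) a i.

(** Inclusion-exclusion one factor at a time: expanding [1 - h j] either drops [j] or moves it to
    [s1]. *)
Lemma mean_prod_onem s1 s2 : uniq (s1 ++ s2) ->
  (forall i, i \in s1 ++ s2 -> D i) ->
  Rintegral P setT (fun w =>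
    Phi w * \prod_(i <- s1) h i w * \prod_(i <- s2) (1 - h i w)) =
  Rintegral P setT Phi * \prod_(i <- s1) a i * \prod_(i <- s2) (1 - a i).
Proof.
elim: s2 s1 => [|j s2 IH] s1 us sD.
  rewrite cats0 in us sD; rewrite !big_nil mulr1 -mean_h//.
  by apply: eq_Rintegral => w _; rewrite big_nil mulr1.
have us1 : uniq (s1 ++ s2).
  by move: us; rewrite -cat1s uniq_catCA => /andP[].
have usj : uniq ((j :: s1) ++ s2) by move: us; rewrite -cat1s uniq_catCA.
have u1 s : unit_valued (fun w => \prod_(i <- s) h i w) by exact: unit_valued_prod.
have u2 s : unit_valued (fun w => \prod_(i <- s) (1 - h i w)).
  by apply: unit_valued_prod => i; exact: unit_valued_onem.
rewrite big_cons mulrCA mulrBl mul1r.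
pose m s := Rintegral P setT (fun w =>
  Phi w * \prod_(i <- s) h i w * \prod_(i <- s2) (1 - h i w)).
transitivity (m s1 - m (j :: s1)).
  rewrite /m -meanB; last 2 first.
  - by apply: unit_valuedM => //; exact: unit_valuedM.
  - by apply: unit_valuedM => //; exact: unit_valuedM.
  by apply: eq_Rintegral => w _; rewrite !big_cons; ring.
rewrite /m !IH//.
- by rewrite big_cons; ring.
- move=> i; rewrite mem_cat inE => /orP[/predU1P[->|i1]|i2]; apply: sD;
    by rewrite mem_cat inE ?eqxx ?i1 ?i2 ?orbT.
- move=> i; rewrite mem_cat => /orP[i1|i2]; apply: sD;
    by rewrite mem_cat inE ?i1 ?i2 ?orbT.
Qed.

End inclusion_exclusion.

Section conditional_law.
Context {d} {Omega : measurableType d} {R : realType} (P : probability Omega R).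
Variables (p : nat -> R) (N : node -> Omega -> nat) (X : node -> Omega -> R).
Variable y : R.
Hypothesis y01 : 0 <= y <= 1.
Hypothesis hX : stationary_rtp P p (bernoulli_law y) N X.

Local Notation mean g := (Rintegral P setT g).

Let mN : forall v, measurable_fun setT (N v) := gw_measurable (rtp_gw hX).

(* The value at v that is attained iff no child of v attains its own. *)
Definition extreme (v : node) : R := if odd (size v) then 0 else 1.

(** The membership test makes this measurable on the whole space, since [X v] is controlled only
    where [v] belongs to the tree. *)
Definition hit (v : node) (w : Omega) : bool :=
  in_tree (N ^~ w) v && (X v w == extreme v).

Lemma measurable_hit (v : node) : measurable_fun setT (hit v).
Proof.
apply: (measurable_fun_bool true); rewrite setTI.
rewrite (_ : _ @^-1` _ =
    [set w | in_tree (N ^~ w) v] `&` X v @^-1` [set extreme v]).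
  by apply: (rtp_measurable hX) => //; exact: measurable_in_tree.
apply/seteqP; split=> w; rewrite /hit /=; first by move=> /andP[? /eqP].
by move=> [-> ->]; rewrite eqxx.
Qed.

Lemma unit_valued_hit (v : node) : unit_valued (fun w => (hit v w)%:R : R).
Proof. by apply: unit_valued_bool; exact: measurable_hit. Qed.

Lemma bernoulli_law1 : bernoulli_law y [set 1] = y%:E.
Proof.
rewrite /bernoulli_law /distribution/= /pushforward /bernoulli_prob y01.
rewrite (_ : _ @^-1` _ = [set true]) ?fsbig_set1//.
apply/seteqP; split=> -[]//=; rewrite /bool01 => /eqP.
by rewrite eq_sym oner_eq0.
Qed.

Lemma bernoulli_law_binary : bernoulli_law y (~` [set 0; 1]) = 0%E.
Proof.
rewrite /bernoulli_law /distribution/= /pushforward.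
rewrite (_ : _ @^-1` _ = set0) ?measure0//.
by apply/seteqP; split=> // -[] /= []; [right|left].
Qed.

(** On each of the countably many structures containing [v], [rtp_cond] for [v] alone gives
    probability 0 to values other than 0 and 1. *)
Lemma ae_binary_even : {ae P, forall w, forall v, in_tree (N ^~ w) v ->
  ~~ odd (size v) -> X v w = 0 \/ X v w = 1}.
Proof.
apply: ae_all_nodes => v.
case: (boolP (odd (size v))) => [_|ev]; first by apply: aeW.
pose n := (size v)./2.
have sv : size v = n.*2 by rewrite -[LHS]odd_double_half (negbTE ev).
pose B : set R := ~` [set 0; 1].
have mB : measurable B by apply: measurableC; exact: measurableU.
pose Z k := [set w | tree_code (N ^~ w) n.*2 = k /\ (in_tree (N ^~ w) v /\ B (X v w))].
have negZ : P.-negligible (\bigcup_k Z k).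
  apply: negligible_bigcup => k.
  have [[w0 [w0k tv]]|no] := pselect (exists w,
    tree_code (N ^~ w) n.*2 = k /\ in_tree (N ^~ w) v); last first.
    rewrite (_ : Z k = set0); first exact: negligible_set0.
    by apply/seteqP; split=> w // [wk [tw _]]; apply: no; exists w.
  have mZ : measurable (Z k).
    have mk : measurable [set w | tree_code (N ^~ w) n.*2 = k].
      rewrite -[X in measurable X]setTI.
      exact: (measurable_tree_code N mN n.*2 measurableT [set k]).
    apply: (measurableI _ ([set w | in_tree (N ^~ w) v] `&` X v @^-1` B) mk).
    by apply: (rtp_measurable hX) => //; exact: measurable_in_tree.
  exists (Z k); split => //.
  have t0 u : u \in [:: v] -> tree_upto (N ^~ w0) n.*2 u /\ size u = n.*2.
    by rewrite inE => /eqP ->; split=> //; split=> //; rewrite sv.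
  have := rtp_cond hX (n := n) (t := tree_upto (N ^~ w0) n.*2) (s := [:: v])
    (B := fun=> B) isT t0 (fun=> mB).
  rewrite big_seq1 bernoulli_law_binary mule0 => <-; congr (P _).
  apply/seteqP; split=> w /= [h1 h2].
    split; first by apply/tree_codeP; rewrite h1.
    by move=> u; rewrite inE => /eqP ->; case: h2.
  split; first by rewrite -w0k; apply/tree_codeP.
  split; last by apply: h2; rewrite inE.
  by have : tree_upto (N ^~ w0) n.*2 v by [split; rewrite ?sv]; rewrite -h1 => -[].
apply: negligibleS negZ => w /= h.
exists (tree_code (N ^~ w) n.*2) => //; split=> //.
apply: contrapT => h'; apply: h => tv _; apply: contrapT => h''; apply: h'.
by split.
Qed.

(** Odd levels inherit binary values through the maximum. A maximum is 0 iff no child is 1, a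
    minimum is 1 iff no child is 0, and these are the extremes of the children: one recursion serves
    both parities. *)
Lemma ae_binary : {ae P, forall w, forall v, in_tree (N ^~ w) v ->
  (X v w = 0 \/ X v w = 1) /\
  (hit v w)%:R = \prod_(i < N v w) (1 - (hit (nat_of_ord i :: v) w)%:R) :> R}.
Proof.
apply: filterS2 ae_binary_even (rtp_rule hX) => w bin rule.
have binary v : in_tree (N ^~ w) v -> X v w = 0 \/ X v w = 1.
  move=> tv; case: (boolP (odd (size v))) => [ov|]; last exact: bin.
  rewrite rule// /node_rule ov.
  by apply: (bigmax_binary _ _ _).1 => i; apply: bin; rewrite /= ?ltn_ord ?ov.
move=> v tv; split; first exact: binary.
have child i : X (nat_of_ord (i : 'I_(N v w)) :: v) w = 0 \/ X (nat_of_ord i :: v) w = 1.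
  by apply: binary; rewrite /= ltn_ord.
rewrite {1}/hit tv/= rule// /node_rule /extreme.
case: ifP => ov.
  rewrite (bigmax_binary _ _ child).2; apply: eq_bigr => i _.
  by rewrite /hit /extreme /= ltn_ord tv ov.
rewrite (bigmin_binary _ _ child).2; apply: eq_bigr => i _.
by rewrite /hit /extreme /= ltn_ord tv ov.
Qed.

Section fixed_tree.
Variables (c : node -> nat) (n : nat).

Let E := [set w | tree_upto (N ^~ w) n.*2 = tree_upto c n.*2].
Let Phi w : R := (w \in E)%:R.

Let mE : measurable E.
Proof.
by apply: (tree_sigma_algebra_sub _ mN); exact: tree_sigma_algebra_upto.
Qed.

Let uPhi : unit_valued Phi := unit_valued_set _ mE.

Lemma mean_hits_bottom (s : seq node) : uniq s ->
  (forall v, v \in s -> in_tree c v /\ size v = n.*2) ->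
  mean (fun w => Phi w * \prod_(v <- s) (hit v w)%:R) =
  mean Phi * \prod_(v <- s) y.
Proof.
move=> us hs.
have ts v : v \in s -> tree_upto c n.*2 v /\ size v = n.*2.
  by move=> /hs[tv sv]; split=> //; split=> //; rewrite sv.
have := rtp_cond hX (n := n) (t := tree_upto c n.*2) (s := s)
  (B := fun=> [set 1]) us ts (fun=> measurable_set1 1).
rewrite (eq_bigr (fun=> y%:E)) => [|v _]; last exact: bernoulli_law1.
rewrite prodEFin.
set A := [set w | _ /\ _] => PA.
have hitE w : E w -> forall v, v \in s -> hit v w = (X v w == 1).
  move=> Ew v /[dup] /ts[tv sv] /hs[tcv _]; rewrite /hit /extreme sv odd_double.
  by move: tv; rewrite -Ew => -[->].
have PhiA : (fun w => Phi w * \prod_(v <- s) (hit v w)%:R) = fun w => (w \in A)%:R.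
  apply/funext => w; rewrite /Phi.
  have [Ew|nEw] := pselect (E w); last first.
    by rewrite memNset// mul0r memNset// => -[].
  rewrite [w \in E]mem_set// mul1r; have [Aw|nAw] := pselect (A w).
    by rewrite mem_set// big_seq big1// => v vs; rewrite hitE// (Aw.2 v vs) eqxx.
  have [v vs nv] : exists2 v, v \in s & X v w != 1.
    apply: contrapT => no; apply: nAw; split=> // v vs.
    by apply: contrapT => /eqP nv; apply: no; exists v.
  by rewrite [w \in A]memNset// (big_rem v vs)/= hitE// (negbTE nv) mul0r.
have uPhih : unit_valued (fun w => Phi w * \prod_(v <- s) (hit v w)%:R).
  by apply: unit_valuedM => //; apply: unit_valued_prod => v; exact: unit_valued_hit.
(* [rtp_cond] does not state that its event is measurable; here its indicator is a product of
   measurable functions. *)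
have mA : measurable A.
  rewrite (_ : A = (fun w => Phi w * \prod_(v <- s) (hit v w)%:R) @^-1` [set 1]).
    by rewrite -[X in measurable X]setTI; exact: uPhih.1.
  rewrite PhiA; apply/seteqP; split=> w /= Aw; first by rewrite mem_set.
  apply: contrapT => nAw; move: Aw; rewrite memNset// => /eqP.
  by rewrite eq_sym oner_eq0.
rewrite PhiA !mean_bool// PA fineM//; exact: fin_num_measure.
Qed.

Lemma tree_upto_in_tree w v : tree_upto (N ^~ w) n.*2 = tree_upto c n.*2 ->
  in_tree c v -> (size v <= n.*2)%N -> in_tree (N ^~ w) v.
Proof.
move=> Ew tv sv; have : tree_upto c n.*2 v by [].
by rewrite -Ew => -[].
Qed.

(* Descending induction from level 2n: v is hit iff none of its children is, so
   inclusion-exclusion turns the claim for j into the claim for j + 1. *)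
Lemma mean_hits (j : nat) (s : seq node) : uniq s ->
  (forall v, v \in s -> in_tree c v /\ (size v + j = n.*2)%N) ->
  mean (fun w => Phi w * \prod_(v <- s) (hit v w)%:R) =
  mean Phi * \prod_(v <- s) nand_value y c j v.
Proof.
elim: j s => [|j IH] s us hs.
  by apply: mean_hits_bottom => // v /hs; rewrite addn0.
pose s' : seq node := [seq i :: v | v <- s, i <- index_iota 0 (c v)].
have us' : uniq s'.
  apply: allpairs_uniq_dep => // [v _|]; first exact: iota_uniq.
  by move=> [v i] [v' i'] _ _ /= [-> ->].
have hs' u : u \in s' -> in_tree c u /\ (size u + j = n.*2)%N.
  move=> /allpairsPdep[v [i [vs]]]; rewrite mem_index_iota => /andP[_ ic] ->.
  by have [tv sv] := hs _ vs; rewrite /= ic tv addSnnS.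
have mhit s1 : uniq s1 -> (forall v, v \in s1 -> in_tree c v /\ (size v + j = n.*2)%N) ->
  mean (fun w => Phi w * \prod_(v <- s1) (hit v w)%:R) =
  mean Phi * \prod_(v <- s1) nand_value y c j v by exact: IH.
have := mean_prod_onem P _ (fun v w => (hit v w)%:R) (nand_value y c j)
  (fun v => in_tree c v /\ (size v + j = n.*2)%N) Phi unit_valued_hit uPhi mhit [::] s' us' hs'.
rewrite big_nil mulr1 big_allpairs_dep/=.
under [X in _ = _ * X -> _]eq_bigr do rewrite big_mkord.
(* The recursion for [hit] holds only almost surely, so the integrands are not compared
   pointwise. *)
move=> <-; apply: ae_eq_mean.
- by apply: unit_valuedM => //; apply: unit_valued_prod => v; exact: unit_valued_hit.
- apply: unit_valuedM.
    apply: unit_valuedM => //.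
    by apply: unit_valued_prod => v; exact: unit_valued_hit.
  by apply: unit_valued_prod => v; apply: unit_valued_onem; exact: unit_valued_hit.
apply: filterS ae_binary => w bin; rewrite big_nil mulr1 /Phi.
have [Ew|nEw] := pselect (E w); last by rewrite memNset// !mul0r.
congr (_ * _); rewrite big_allpairs_dep/= big_seq [RHS]big_seq; apply: eq_bigr => v vs.
have [tv sv] := hs v vs.
have svn : (size v < n.*2)%N by rewrite -sv addnS ltnS leq_addr.
rewrite (bin v _).2; last by apply: tree_upto_in_tree => //; exact: ltnW.
rewrite big_mkord (tree_upto_eq_offspring c (N ^~ w) n.*2)//.
Qed.

Lemma mean_hit_root :
  mean (fun w => Phi w * (hit [::] w)%:R) = mean Phi * nand_value y c n.*2 [::].
Proof.
have := mean_hits n.*2 [:: [::]] isT; rewrite big_seq1 => <-.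
  by apply: eq_Rintegral => w _; rewrite big_seq1.
by move=> v; rewrite inE => /eqP ->.
Qed.

End fixed_tree.

(** The characterising property of conditional probability: S at the root is a version of P(X = 1 |
    tree up to level 2n). It is proved structure by structure, S being constant on each. *)
Lemma mean_hit_determined (n : nat) (B : set Omega) : tree_determined N n.*2 B ->
  mean (fun w => (w \in B)%:R * (hit [::] w)%:R) =
  mean (fun w => (w \in B)%:R * nand_value y (N ^~ w) n.*2 [::]).
Proof.
move=> detB.
have uB : unit_valued (fun w => (w \in B)%:R : R).
  by apply: unit_valued_set; exact: tree_determined_measurable detB.
have u1 : unit_valued (fun w => (w \in B)%:R * (hit [::] w)%:R : R).
  by apply: unit_valuedM => //; exact: unit_valued_hit.
have u2 : unit_valued (fun w => (w \in B)%:R * nand_value y (N ^~ w) n.*2 [::]).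
  by apply: unit_valuedM => //; exact: (unit_valued_nand_value P p N (rtp_gw hX)).
have mcode := measurable_tree_code N mN n.*2.
have c1 := mean_partition P _ _ mcode u1.
have c2 := mean_partition P _ _ mcode u2.
rewrite -(cvg_lim _ c1)// -(cvg_lim _ c2)//; congr (limn (series _)).
apply/funext => k.
have [[w0 [Bw0 w0k]]|no] := pselect (exists w, B w /\ tree_code (N ^~ w) n.*2 = k); last first.
  apply: eq_Rintegral => w _.
  have [Bw|nBw] := pselect (B w); last by rewrite memNset// !mul0r.
  by case: eqP => [wk|_]; [exfalso; apply: no; exists w|rewrite /= !mulr0].
(* If [B] meets the class of a tree structure, it contains all of it. *)
have inE' w : (w \in B)%:R * (tree_code (N ^~ w) n.*2 == k)%:R =
    (w \in [set w | tree_upto (N ^~ w) n.*2 = tree_upto (N ^~ w0) n.*2])%:R :> R.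
  case: eqP => [wk|nwk].
    have ww0 : tree_upto (N ^~ w0) n.*2 = tree_upto (N ^~ w) n.*2.
      by apply/tree_codeP; rewrite w0k wk.
    by rewrite !mem_set ?mulr1//; exact: detB ww0 Bw0.
  by rewrite mulr0 memNset// => /tree_codeP ww0; apply: nwk; rewrite ww0.
transitivity (mean (fun w => (w \in
    [set w | tree_upto (N ^~ w) n.*2 = tree_upto (N ^~ w0) n.*2])%:R *
    (hit [::] w)%:R : R)).
  by apply: eq_Rintegral => w _; rewrite -inE' mulrAC.
rewrite mean_hit_root -RintegralZr//; last first.
  apply: unit_valued_integrable; apply: unit_valued_set.
  by apply: (tree_sigma_algebra_sub _ mN); exact: tree_sigma_algebra_upto.
apply: eq_Rintegral => w _; rewrite mulrAC inE'.
have [ww0|nww0] := pselect (tree_upto (N ^~ w) n.*2 = tree_upto (N ^~ w0) n.*2);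
  last first.
  by rewrite memNset// !mul0r.
by congr (_ * _); apply: (nand_value_tree_upto _ _ _ n.*2).
Qed.

End conditional_law.

(** * Approximation by tree-determined events *)

Section symmetric_difference.
Context {d} {T : measurableType d} {R : realType} (P : probability T R).

(** The probability of the symmetric difference, as a mean so that its inequalities reduce to
    pointwise ones on booleans. *)
Definition sdiff_mean (A B : set T) : R :=
  Rintegral P setT (fun w => ((w \in A) (+) (w \in B))%:R).

Lemma unit_valued_sdiff (A B : set T) : measurable A -> measurable B ->
  unit_valued (fun w => ((w \in A) (+) (w \in B))%:R : R).
Proof.
move=> mA mB.
have h (a b : bool) : (a (+) b)%:R = 1 - (1 - a%:R * (1 - b%:R)) * (1 - b%:R * (1 - a%:R)) :> R.
  by case: a; case: b => /=; ring.
under eq_fun do rewrite h.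
have uA := unit_valued_set (R := R) _ mA; have uB := unit_valued_set (R := R) _ mB.
apply: unit_valued_onem; apply: unit_valuedM; apply: unit_valued_onem;
  by apply: unit_valuedM => //; exact: unit_valued_onem.
Qed.

Lemma sdiff_mean_triangle (A B C : set T) :
  measurable A -> measurable B -> measurable C ->
  sdiff_mean A C <= sdiff_mean A B + sdiff_mean B C.
Proof.
move=> mA mB mC.
have uAB := unit_valued_sdiff _ _ mA mB; have uBC := unit_valued_sdiff _ _ mB mC.
apply: mean_leD => //; first exact: unit_valued_sdiff.
by move=> w; case: (_ \in A); case: (_ \in B); case: (_ \in C) => /=; lra.
Qed.

Lemma sdiff_meanU (A A' B B' : set T) :
  measurable A -> measurable A' -> measurable B -> measurable B' ->
  sdiff_mean (A `|` A') (B `|` B') <= sdiff_mean A B + sdiff_mean A' B'.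
Proof.
move=> mA mA' mB mB'.
have uAB := unit_valued_sdiff _ _ mA mB; have uAB' := unit_valued_sdiff _ _ mA' mB'.
apply: mean_leD => //; first by apply: unit_valued_sdiff; exact: measurableU.
move=> w; rewrite !in_setU.
by case: (_ \in A); case: (_ \in A'); case: (_ \in B); case: (_ \in B') => /=; lra.
Qed.

Lemma sdiff_meanC (A B : set T) : sdiff_mean (~` A) (~` B) = sdiff_mean A B.
Proof.
by apply: eq_Rintegral => w _; rewrite !in_setC; case: (_ \in A); case: (_ \in B).
Qed.

Lemma sdiff_meanxx (A : set T) : sdiff_mean A A = 0.
Proof.
rewrite -[RHS](mean_cst P); apply: eq_Rintegral => w _.
by rewrite addbb.
Qed.

Lemma sdiff_mean_bigcup (F : nat -> set T) : (forall k, measurable (F k)) ->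
  forall e : R, 0 < e -> exists n,
    sdiff_mean (\bigcup_k F k) (\big[setU/set0]_(k < n) F k) < e.
Proof.
move=> mF e e0.
pose U n := \big[setU/set0]_(k < n) F k.
have mU n : measurable (U n) by apply: bigsetU_measurable.
have mbig : measurable (\bigcup_k F k) by exact: bigcup_measurable.
have subU n : U n `<=` \bigcup_k F k by exact: bigsetU_bigcup.
have sdE n : sdiff_mean (\bigcup_k F k) (U n) = fine (P (\bigcup_k F k)) - fine (P (U n)).
  have uV := unit_valued_set (R := R) _ mbig; have uU := unit_valued_set (R := R) _ (mU n).
  rewrite -!(mean_bool P)// -meanB//; apply: eq_Rintegral => w _.
  have [Uw|nUw] := pselect (U n w); last by rewrite [_ \in U n]memNset// addbF subr0.
  by have Vw := subU n w Uw; rewrite !mem_set//= subrr.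
have cU : (fun n => fine (P (U n.+1))) @ \oo --> fine (P (\bigcup_k F k)).
  apply: fine_cvg; rewrite fineK; last exact: fin_num_measure.
  have UV : \bigcup_n U n.+1 = \bigcup_k F k by exact: bigcup_bigsetU_bigcup.
  rewrite -UV.
  apply: (@nondecreasing_cvg_mu _ _ _ P (fun n => U n.+1)) => //.
    by rewrite UV.
  by move=> a b ab; rewrite subsetEset; exact: subset_bigsetU.
move: cU => /cvgrPdist_lt/(_ _ e0)[n _ /(_ n (leqnn n))] /= Un.
by exists n.+1; rewrite sdE; apply: le_lt_trans Un; exact: ler_norm.
Qed.

End symmetric_difference.

Section endogeny.
Context {d} {Omega : measurableType d} {R : realType} (P : probability Omega R).
Variables (p : nat -> R) (N : node -> Omega -> nat) (X : node -> Omega -> R).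

Local Notation mean g := (Rintegral P setT g).
Local Notation S y m := (fun w => nand_value y (N ^~ w) m [::]).

(** Good-sets argument: the approximable events form a sigma-algebra containing the generators. For
    a countable union, half of [e] pays for truncating it and half for approximating the finite
    union. *)
Lemma tree_sigma_algebra_approx (A : set Omega) :
  (forall v, measurable_fun setT (N v)) -> tree_sigma_algebra N A ->
  forall e : R, 0 < e ->
  exists n B, tree_determined N n B /\ sdiff_mean P A B < e.
Proof.
move=> mN tA.
have mdet n B : tree_determined N n B -> measurable B.
  exact: tree_determined_measurable.
pose C : set (set Omega) := [set A' | measurable A' /\ forall e : R, 0 < e ->
    exists n B, tree_determined N n B /\ sdiff_mean P A' B < e].
suff : C A by case.
apply: (tA C); split; last first.
  move=> _ [v ->]; split; first exact: measurable_in_tree.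
  move=> e e0; exists (size v), [set w | in_tree (N ^~ w) v]; split.
    move=> w w' ww' tv; have : tree_upto (N ^~ w) (size v) v by [].
    by rewrite ww' => -[].
  by rewrite sdiff_meanxx.
split.
- split=> // e e0; exists 0%N, set0; split; first by move=> w w' _.
  by rewrite sdiff_meanxx.
- move=> A' [mA' aA']; rewrite setTD; split; first exact: measurableC.
  move=> e /aA'[n [B [detB AB]]]; exists n, (~` B).
  rewrite sdiff_meanC; split=> // w w' /esym ww' nBw Bw'; apply: nBw.
  exact: detB ww' Bw'.
- move=> F aF.
  have mF k : measurable (F k) := (aF k).1.
  split; first exact: bigcup_measurable.
  have aU n : forall e : R, 0 < e -> exists m B, tree_determined N m B /\
      sdiff_mean P (\big[setU/set0]_(k < n) F k) B < e.
    elim: n => [|n IH] e e0.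
      by exists 0%N, set0; rewrite big_ord0 sdiff_meanxx; split=> // w w' _.
    have e20 : 0 < e / 2 by rewrite divr_gt0.
    have [m1 [B1 [det1 AB1]]] := IH _ e20.
    have [m2 [B2 [det2 AB2]]] := (aF n).2 _ e20.
    exists (maxn m1 m2), (B1 `|` B2); split.
      move=> w w' ww' [B1w|B2w]; [left|right].
        exact: (tree_determined_leq _ _ _ _ (leq_maxl m1 m2) det1 _ _ ww').
      exact: (tree_determined_leq _ _ _ _ (leq_maxr m1 m2) det2 _ _ ww').
    rewrite big_ord_recr/= [e]splitr; apply: le_lt_trans (ltrD AB1 AB2).
    apply: sdiff_meanU => //; [exact: bigsetU_measurable|exact: mdet det1|exact: mdet det2].
  move=> e e0; have e20 : 0 < e / 2 by rewrite divr_gt0.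
  have [n Fn] := sdiff_mean_bigcup P _ mF _ e20.
  have [m [B [detB UB]]] := aU n _ e20.
  exists m, B; split=> //; rewrite [e]splitr; apply: le_lt_trans (ltrD Fn UB).
  apply: sdiff_mean_triangle; [exact: bigcup_measurable|exact: bigsetU_measurable|exact: mdet detB].
Qed.

Variable y : R.
Hypothesis hX : stationary_rtp P p (bernoulli_law y) N X.

Let mN : forall v, measurable_fun setT (N v) := gw_measurable (rtp_gw hX).

Let H := [set w | X [::] w = 1].

Let hitE w : hit N X [::] w = (w \in H).
Proof.
by rewrite /hit /extreme /=; apply/eqP/idP => [?|/set_mem//]; rewrite mem_set.
Qed.

Lemma measurable_root : measurable [set w | X [::] w = 1].
Proof.
have := rtp_measurable hX (measurable_in_tree N mN [::]) (measurable_set1 1).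
rewrite (_ : _ `&` _ = [set w | X [::] w = 1])//; apply/seteqP; split=> w; [by case|by split].
Qed.

(** The indicator of [H] enters the symmetric difference linearly, multiplied by functions of the
    truncated tree, hence may be replaced by S. *)
Lemma sdiff_root_determined (n : nat) (B : set Omega) : 0 <= y <= 1 ->
  tree_determined N n.*2 B ->
  sdiff_mean P H B = mean (fun w => if w \in B then 1 - S y n.*2 w else S y n.*2 w).
Proof.
move=> y01 detB.
have mH : measurable H := measurable_root.
have mB := tree_determined_measurable _ mN _ _ detB.
have detT : tree_determined N n.*2 setT by [].
have uB := unit_valued_set (R := R) _ mB; have uH := unit_valued_set (R := R) _ mH.
have uS := unit_valued_nand_value P p N (rtp_gw hX) y n.*2 [::] y01.
have uBH := unit_valuedM _ _ uB uH; have uBS := unit_valuedM _ _ uB uS.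
have u1 := unit_valuedM _ _ uH (unit_valued_onem _ uB).
have u2 := unit_valuedM _ _ uB (unit_valued_onem _ uH).
have u3 := unit_valuedM _ _ uS (unit_valued_onem _ uB).
have u4 := unit_valuedM _ _ uB (unit_valued_onem _ uS).
have HS : mean (fun w => (w \in H)%:R) = mean (S y n.*2).
  have := mean_hit_determined P p N X y y01 hX n setT detT.
  under [X in X = _ -> _]eq_Rintegral do rewrite hitE in_setT mul1r.
  under [X in _ = X -> _]eq_Rintegral do rewrite in_setT mul1r.
  by [].
have BHS : mean (fun w => (w \in B)%:R * (w \in H)%:R) =
    mean (fun w => (w \in B)%:R * S y n.*2 w).
  have := mean_hit_determined P p N X y y01 hX n B detB.
  by under [X in X = _ -> _]eq_Rintegral do rewrite hitE.
transitivity (mean (fun w => (w \in H)%:R) - mean (fun w => (w \in B)%:R * (w \in H)%:R) +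
  (mean (fun w => (w \in B)%:R) - mean (fun w => (w \in B)%:R * (w \in H)%:R))).
  rewrite -!meanB//.
  rewrite -meanD.
  - by apply: eq_Rintegral => w _; case: (_ \in H); case: (_ \in B) => /=; ring.
  - rewrite (_ : (fun w => _) = fun w => (w \in H)%:R * (1 - (w \in B)%:R))//.
    by apply/funext => w; ring.
  - rewrite (_ : (fun w => _) = fun w => (w \in B)%:R * (1 - (w \in H)%:R))//.
    by apply/funext => w; ring.
rewrite HS BHS -!meanB// -meanD.
- by apply: eq_Rintegral => w _; case: (_ \in B) => /=; ring.
- rewrite (_ : (fun w => _) = fun w => S y n.*2 w * (1 - (w \in B)%:R))//.
  by apply/funext => w; ring.
- rewrite (_ : (fun w => _) = fun w => (w \in B)%:R * (1 - S y n.*2 w))//.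
  by apply/funext => w; ring.
Qed.

End endogeny.

Section endogeny_criterion.
Context {d} {Omega : measurableType d} {R : realType} (P : probability Omega R).
Variables (p : nat -> R) (N : node -> Omega -> nat) (X : node -> Omega -> R).
Hypothesis hp : offspring_distribution p.

Local Notation mean g := (Rintegral P setT g).
Local Notation S y m := (fun w => nand_value y (N ^~ w) m [::]).

Let H := [set w | X [::] w = 1].

(** The mean conditional variance of the root value given the tree up to level 2n, not the variance
    of S. *)
Definition root_variance (y : R) (n : nat) : R :=
  nand_mean p y n.*2 - nand_sqmean p y n.*2.

Lemma root_varianceE (y : R) (n : nat) : galton_watson P p N -> 0 <= y <= 1 ->
  root_variance y n = mean (fun w => S y n.*2 w * (1 - S y n.*2 w)).
Proof.
move=> hN y01; rewrite /root_variance -(mean_nand_root P p N hp hN)//.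
rewrite -(mean_sq_nand_root P p N hp hN)// -meanB.
- by apply: eq_Rintegral => w _; ring.
- exact: (unit_valued_nand_value P p N hN).
- under eq_fun do rewrite expr2.
  by apply: unit_valuedM; exact: (unit_valued_nand_value P p N hN).
Qed.

(** Any guess [B] made from the truncated tree errs with conditional probability S or 1 - S, each at
    least S(1 - S). *)
Lemma endogenous_root_variance (y : R) : 0 <= y <= 1 ->
  stationary_rtp P p (bernoulli_law y) N X -> endogenous P N X ->
  forall e : R, 0 < e -> exists n, root_variance y n < e.
Proof.
move=> y01 hX [Y [mY XY]] e e0.
have hN := rtp_gw hX; have mN := gw_measurable hN.
pose A := Y @^-1` [set 1].
have tA : tree_sigma_algebra N A by exact: mY (measurable_set1 1).
have mA : measurable A by exact: (tree_sigma_algebra_sub N mN A tA).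
have mH : measurable H := measurable_root P p N X y hX.
have HA : sdiff_mean P H A = 0.
  rewrite -[RHS](mean_cst P); apply: ae_eq_mean.
  - exact: unit_valued_sdiff.
  - by apply: unit_valued_cst; rewrite lexx ler01.
  apply: filterS XY => w XYw.
  have -> : (w \in H) = (w \in A); last by rewrite addbb.
  by apply/idP/idP => /set_mem h; apply/mem_set; rewrite /H /A/= ?XYw// -XYw.
have [m [B [detB AB]]] := tree_sigma_algebra_approx P N A mN tA e e0.
have mB := tree_determined_measurable _ mN _ _ detB.
(* The conditional law is available at even levels only; a deeper level still determines [B]. *)
have detB2 : tree_determined N m.*2 B.
  by apply: tree_determined_leq detB; rewrite -addnn leq_addr.
exists m; apply: le_lt_trans AB; rewrite -[leRHS]add0r -HA.
apply: le_trans (sdiff_mean_triangle P H A B mH mA mB).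
rewrite (sdiff_root_determined P p N X y hX m B y01 detB2) root_varianceE//.
have uS := unit_valued_nand_value P p N hN y m.*2 [::] y01.
have uB := unit_valued_set (R := R) _ mB.
apply: mean_le.
- by apply: unit_valuedM => //; exact: unit_valued_onem.
- by apply: unit_valued_if => //; exact: unit_valued_onem.
- move=> w; have /andP[S0 S1] := uS.2 w; case: ifP => _; nra.
Qed.

(** Guessing 1 when S > 1/2 errs with conditional probability min(S, 1 - S) <= 2 S(1 - S). Summable
    errors and Borel-Cantelli make the guesses eventually correct almost surely. *)
Lemma root_variance_endogenous (y : R) : 0 <= y <= 1 ->
  stationary_rtp P p (bernoulli_law y) N X ->
  (forall e : R, 0 < e -> exists n, root_variance y n < e) -> endogenous P N X.
Proof.
move=> y01 hX var0.
have hN := rtp_gw hX; have mN := gw_measurable hN.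
have mH : measurable H := measurable_root P p N X y hX.
have approx k : exists B, tree_sigma_algebra N B /\ sdiff_mean P H B < 1 / (2 ^ k.+1)%:R.
  have e0 : 0 < 1 / (2 ^ k.+1)%:R / 2 :> R by rewrite !divr_gt0// ltr0n expn_gt0.
  have [n vn] := var0 _ e0.
  pose B := [set w | 1 / 2 < S y n.*2 w].
  have detB : tree_determined N n.*2 B.
    move=> w w' ww'; rewrite /B/= => h.
    by rewrite -(nand_value_tree_upto y _ _ _ ww').
  exists B; split; first exact: tree_determined_sigma_algebra detB.
  have mB := tree_determined_measurable _ mN _ _ detB.
  have uS := unit_valued_nand_value P p N hN y n.*2 [::] y01.
  have uB := unit_valued_set (R := R) _ mB.
  rewrite (sdiff_root_determined P p N X y hX n B y01 detB).
  have uV : unit_valued (fun w => S y n.*2 w * (1 - S y n.*2 w)).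
    by apply: unit_valuedM => //; exact: unit_valued_onem.
  apply: le_lt_trans (_ : root_variance y n + root_variance y n < _); last lra.
  rewrite root_varianceE//; apply: mean_leD => //.
    by apply: unit_valued_if => //; exact: unit_valued_onem.
  move=> w; have /andP[S0 S1] := uS.2 w; case: ifP => [/set_mem|/negbT/negP nB].
    by rewrite /B/=; nra.
  have : ~ B w by move=> /mem_set.
  by rewrite /B/= => /negP; rewrite -leNgt; nra.
have [B hB] := choice approx.
have tB k : tree_sigma_algebra N (B k) := (hB k).1.
have mB k : measurable (B k) by exact: (tree_sigma_algebra_sub N mN _ (tB k)).
pose F k := [set w | (w \in H) (+) (w \in B k)].
(* The limit superior stays in the sigma-algebra of the tree, unlike the event [H] that it matches
   almost surely. *)
pose L := lim_sup_set B.
have tL : tree_sigma_algebra N L.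
  apply: tree_sigma_algebra_bigcap => n; rewrite bigcup_mkcond.
  apply: tree_sigma_algebra_bigcup => k; case: ifP => // _; exact: tree_sigma_algebra0.
exists (fun w => (w \in L)%:R); split.
  by move=> V mV; rewrite preimage_indic; case: ifP => _; case: ifP => _ //;
    [rewrite -setC0; apply: tree_sigma_algebraC|exact: tree_sigma_algebraC|];
    exact: tree_sigma_algebra0.
have mF k : measurable (F k).
  have [mf _] := unit_valued_sdiff (R := R) _ _ mH (mB k).
  rewrite (_ : F k = (fun w => ((w \in H) (+) (w \in B k))%:R : R) @^-1` [set 1]).
    by rewrite -[X in measurable X]setTI; exact: mf.
  apply/seteqP; split=> w; rewrite /F/=; first by move=> ->.
  by case: (_ (+) _) => // /eqP; rewrite eq_sym oner_eq0.
have PF k : (P (F k) <= (1 / (2 ^ k.+1)%:R)%:E)%E.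
  rewrite -[P (F k)]fineK ?fin_num_measure// lee_fin -mean_bool//.
  apply: le_trans (ltW (hB k).2); rewrite le_eqVlt; apply/orP; left; apply/eqP.
  apply: eq_Rintegral => w _; congr (nat_of_bool _)%:R.
  by apply/idP/idP => [/set_mem//|?]; exact/mem_set.
have F0 : P (lim_sup_set F) = 0%E.
  apply: lim_sup_set_cvg0 => //.
  apply: (@le_lt_trans _ _ (\sum_(k <oo) (1 / (2 ^ k.+1)%:R)%:E)%E).
    by apply: lee_nneseries => // k _; exact: PF.
  apply: le_lt_trans (epsilon_trick0 _ _) _ => //; exact: ltry.
have nF : {ae P, forall w, ~ lim_sup_set F w}.
  exists (lim_sup_set F); split => //.
    by apply: bigcapT_measurable => n; apply: bigcup_measurable.
  by move=> w /contrapT.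
have ab := ae_binary P p N X y hX.
apply: filterS2 nF ab => w nFw /(_ [::] isT)[bin _].
have [n Fn] : exists n, forall k, (n <= k)%N -> ~ F k w.
  apply: contrapT => no; apply: nFw => n _; apply: contrapT => nFn; apply: no.
  by exists n => k nk Fk; apply: nFn; exists k.
have HB k : (n <= k)%N -> (w \in H) = (w \in B k).
  by move=> /Fn; rewrite /F/=; case: (_ \in H); case: (_ \in B k).
have HL : (w \in H) = (w \in L).
  apply/idP/idP => [wH|/set_mem wL].
    apply/mem_set => m _; exists (maxn m n); first exact: leq_maxl.
    by apply: set_mem; rewrite -HB// leq_maxr.
  by have [k /= nk Bk] := wL n I; rewrite (HB k nk); exact: mem_set.
rewrite -HL; case: bin => Xw.
  by rewrite memNset// /H/= Xw => /eqP; rewrite eq_sym oner_eq0.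
by rewrite mem_set.
Qed.

End endogeny_criterion.

Lemma two_copies_orbit_nand {d} {Omega : measurableType d} {R : realType}
    (P : probability Omega R) (p : nat -> R) (N : node -> Omega -> nat) (x : R) :
  offspring_distribution p -> galton_watson P p N -> 0 < x < 1 ->
  minimax_map p x = x ->
  exists q, [/\ two_copies_orbit p x q, q 0%N < x &
    forall n, x - q n = root_variance p (1 - x) n].
Proof.
move=> hp hN hx hfx.
have y01 : 0 <= 1 - x <= 1 by lra.
have fix1 := offspring_gf_fixed p x hfx.
have m_even n : nand_mean p (1 - x) n.*2 = 1 - x.
  by elim: n => [//|n IH]; rewrite doubleS/= IH subKr.
have m_odd n : nand_mean p (1 - x) n.*2.+1 = offspring_gf p x.
  by rewrite /= m_even subKr.
(* P(both 0) = 1 - 2 P(X = 1) + P(both 1), with P(X = 1) = 1 - x and P(both 1) = E[S^2]. *)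
pose q n := 2 * x - 1 + nand_sqmean p (1 - x) n.*2.
have sq_odd n : nand_sqmean p (1 - x) n.*2.+1 = offspring_gf p (q n).
  by rewrite /= m_even; congr offspring_gf; rewrite /q; ring.
(* This is E[(1 - S)^2]. At an even level it equals [q n]; at an odd level it is the argument of the
   outer G. *)
have sq_onem m : 0 <= 1 - 2 * nand_mean p (1 - x) m + nand_sqmean p (1 - x) m.
  rewrite -(mean_nand_root P p N hp hN)// -(mean_sq_nand_root P p N hp hN)//.
  have uS := unit_valued_nand_value P p N hN (1 - x) m [::] y01.
  set f := (fun w => _) in uS; set Mf := Rintegral _ _ _.
  have uf1 := unit_valued_onem _ uS.
  have uff : unit_valued (fun w => f w * (1 - f w)) by exact: unit_valuedM.
  have -> : 1 - 2 * Mf + Rintegral P setT (fun w => f w ^+ 2) =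
      Rintegral P setT (fun w => (1 - f w) * (1 - f w)).
    have -> : (fun w => (1 - f w) * (1 - f w)) = fun w => (1 - f w) - f w * (1 - f w).
      by apply/funext => w; ring.
    rewrite meanB// meanB//; last by apply: unit_valued_cst; rewrite ler01 lexx.
    rewrite mean_cst.
    have -> : (fun w => f w * (1 - f w)) = fun w => f w - f w ^+ 2.
      by apply/funext => w; ring.
    rewrite meanB//; last by under eq_fun do rewrite expr2; exact: unit_valuedM.
    by rewrite -/Mf; ring.
  by case/andP: (mean_bounds P _ (unit_valuedM _ _ uf1 uf1)).
have sq_le m : nand_sqmean p (1 - x) m <= nand_mean p (1 - x) m.
  rewrite -(mean_nand_root P p N hp hN)// -(mean_sq_nand_root P p N hp hN)//.
  have uS := unit_valued_nand_value P p N hN (1 - x) m [::] y01.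
  apply: mean_le => //; first by under eq_fun do rewrite expr2; exact: unit_valuedM.
  by move=> w; have /andP[S0 S1] := uS.2 w; rewrite expr2 ler_piMr.
exists q; split.
- move=> n; split.
  + have := sq_onem n.*2; have := sq_le n.*2; rewrite /q m_even; lra.
  + by have := sq_onem n.*2.+1; rewrite m_odd sq_odd.
  + have sqS m : nand_sqmean p (1 - x) m.+1 = offspring_gf p
        (1 - 2 * nand_mean p (1 - x) m + nand_sqmean p (1 - x) m) by [].
    by rewrite {1}/q doubleS sqS m_odd sq_odd.
(* At level 0 the copies are independent, so [q 0 = x ^ 2 < x]. *)
- rewrite /q /=; nra.
- by move=> n; rewrite /root_variance m_even /q; ring.
Qed.

Theorem theorem3p1 (R : realType) (p : nat -> R)
  (hp : offspring_distribution p) (hp1 : p 1%N != 1)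
  (x : R) (hx : 0 < x < 1) (hfx : minimax_map p x = x)
  (d : measure_display) (Omega : measurableType d) (P : probability Omega R)
  (N : node -> Omega -> nat) (X : node -> Omega -> R)
  (hX : stationary_rtp P p (bernoulli_law (1 - x)) N X) :
  endogenous P N X <-> derive1 (minimax_map p) x <= 1.
Proof.
have y01 : 0 <= 1 - x <= 1 by lra.
have [q [orb q0 var]] := two_copies_orbit_nand P p N x hp (rtp_gw hX) hx hfx.
split=> [endo|f1].
  rewrite leNgt; apply/negP => f1.
  have [delta delta0 qd] := two_copies_away_from_fixed p hp hp1 x q hx hfx orb q0 f1.
  have [n] := endogenous_root_variance P p N X hp (1 - x) y01 hX endo delta delta0.
  by rewrite -var ltNge qd.
apply: (root_variance_endogenous P p N X hp (1 - x)) => // e e0.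
have [n qn] := two_copies_to_fixed p hp hp1 x q hx hfx orb f1 e e0.
by exists n; rewrite -var.
Qed.
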